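(* Let $k,r,n$ be integers with $n\ge k\ge 5$ and $3\le r\le \lfloor (k-1)/2\rfloor+1$, and let $\mathcal{H}=\{K_r\}\cup\mathcal{C}_{\ge k}$. If $n\ge \frac{k^3}{4}$, then $$\mathrm{ex}(n,\mathcal{H})=e(G_2),$$ where $G_2=T(\lfloor (k-1)/2\rfloor,\,r-2)\vee I_{\,n-\lfloor (k-1)/2\rfloor}$.
   Context: Graphs are finite and simple; $e(G)$ is the number of edges of $G$. $\mathcal{C}_{\ge k}$ is the set of all cycles of length at least $k$. A graph is $\mathcal{H}$-free if it contains no member of $\mathcal{H}$ as a (not necessarily induced) subgraph; $\mathrm{ex}(n,\mathcal{H})$ is the maximum number of edges in an $n$-vertex $\mathcal{H}$-free graph. $T(m,s)$ is the balanced complete $s$-partite graph on $m$ vertices (Turán graph; $T(m,1)$ has no edges). $I_m$ is the graph with $m$ vertices and no edges. The join $F_1\vee F_2$ of vertex-disjoint graphs is obtained from $F_1\cup F_2$ by joining every vertex of $F_1$ to every vertex of $F_2$. *)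

(* Defs.v *)
From HB Require Import structures.
From mathcomp Require Import all_boot.
From mathcomp Require Import boolp classical_sets.

Set Implicit Arguments.
Unset Strict Implicit.
Unset Printing Implicit Defensive.

Record sgraph (V : finType) := SGraph {
  edges : {set {set V}};
  edges_card2 : [forall A in edges, #|A| == 2]
}.

HB.instance Definition _ (V : finType) := [isSub for @edges V].
HB.instance Definition _ (V : finType) := [Finite of sgraph V by <:].

Definition adj (V : finType) (G : sgraph V) (x y : V) : bool :=
  [set x; y]%SET \in edges G.

Definition num_edges (V : finType) (G : sgraph V) : nat := #|edges G|.

Definition edges_of_rel (V : finType) (e : rel V) : {set {set V}} :=
  [set A : {set V} | [exists x, exists y,
     [&& x != y, e x y & A == [set x; y]%SET]]]%SET.

Lemma edges_of_rel_card2 (V : finType) (e : rel V) :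
  [forall A in edges_of_rel e, #|A| == 2].
Proof.
apply/'forall_implyP=> A; rewrite inE.
case/existsP=> x /existsP[y /and3P[neq_xy _ /eqP->]].
by rewrite cards2 neq_xy.
Qed.

(* [e] need not be symmetric or irreflexive: [x] and [y] are adjacent iff they
   are distinct and [e x y] or [e y x]. *)
Definition graph_of_rel (V : finType) (e : rel V) : sgraph V :=
  SGraph (edges_of_rel_card2 e).

Definition complete_graph (r : nat) : sgraph 'I_r :=
  graph_of_rel (fun _ _ => true).

(* The cycle of length [l] when [3 <= l]; [ordS] is the successor modulo [l]. *)
Definition cycle_graph (l : nat) : sgraph 'I_l :=
  graph_of_rel (fun i j => j == ordS i).

Definition empty_graph (m : nat) : sgraph 'I_m :=
  graph_of_rel (fun _ _ => false).

(* For [0 < s], the parts are the residue classes modulo [s] in {0, ..., m-1},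
   whose sizes differ pairwise by at most one. *)
Definition turan_graph (m s : nat) : sgraph 'I_m :=
  graph_of_rel (fun i j : 'I_m => i %% s != j %% s).

Definition join_graph (V W : finType) (G : sgraph V) (H : sgraph W) :
    sgraph (V + W)%type :=
  graph_of_rel (fun x y =>
    match x, y with
    | inl v, inl v' => adj G v v'
    | inr w, inr w' => adj H w w'
    | _, _ => true
    end).

Definition contains (V W : finType) (G : sgraph V) (H : sgraph W) : Prop :=
  exists f : W -> V,
    injective f /\ forall x y, adj H x y -> adj G (f x) (f y).

(* Containment is invariant under isomorphism, so it is enough for families of
   forbidden graphs to have members with vertex sets {0, ..., m-1}. *)
Record fgraph := FGraph { nvertices : nat; graph_on : sgraph 'I_nvertices }.

Definition free (F : set fgraph) (V : finType) (G : sgraph V) : Prop :=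
  forall H : fgraph, F H -> ~ contains G (graph_on H).

(* The maximum is a genuine one as soon as some graph on [n] vertices is
   [F]-free, e.g. when every member of [F] has an edge; otherwise it is 0. *)
Definition ex_num (n : nat) (F : set fgraph) : nat :=
  \max_(G : sgraph 'I_n | `[< free F G >]) num_edges G.

(* Meaningful for [3 <= k], since [cycle_graph l] is not a cycle for [l < 3]. *)
Definition cycles_ge (k : nat) : set fgraph :=
  [set FGraph (cycle_graph l) | l in [set l : nat | k <= l]]%classic.

Definition clique_and_long_cycles (r k : nat) : set fgraph :=
  ([set FGraph (complete_graph r)] `|` cycles_ge k)%classic.

(* Main.v *)
Require Import Defs.
From mathcomp Require Import all_boot.
From mathcomp Require Import zify.
From mathcomp Require boolp.

(** Write t = (k - 1) / 2 and s = r - 2, so that 1 <= s < t and the extremal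
    graph is T(t, s) joined to an independent set.  It has t (n - t) + e(T(t, s))
    edges; it is (s + 1)-partite, hence free of cliques on s + 2 vertices, and at
    least half of the vertices of any cycle in it belong to T(t, s), so that
    cycles have at most 2t < k vertices.  The other direction bounds the number
    of edges of a graph with no clique on s + 2 vertices and no cycle on more
    than 2t + 1 vertices, whatever the parity of k; note that k <= 2t + 2.

    The bound is proved by induction in the form
      e(U) + min(D, ceil((|U| - 1) / (2t + 2))) <= t (|U| - 1)
    for all nonempty vertex sets U, where D = t (t - 1) - e(T(t, s))
    ([sparse], [sparse_all]).  The minimum is D once |U| is of the order of
    k^3 / 4, and then the inequality is the theorem ([edges_bound]).  Being
    subadditive, and growing by at most 1 on an interval of length 2t + 2, the
    correction term makes a minimal violation U rigid: U has no cut vertex, all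
    degrees are at least t, and a set of at most t vertices of degree t is
    independent, since otherwise deleting it would destroy too few edges
    ([sparse_step]).  Sets of at most 2t + 1 vertices are handled by the Turan
    bound for cliques on t + 1 vertices.

    It remains to understand graphs with these three properties, more than
    2t + 1 vertices and no cycle on more than 2t + 1 vertices
    ([tight_structure]).  Let P be a longest path.  The degrees of its two ends
    add up to at most 2t + 1 ([longest_degree_sum]): if a neighbour of the first
    vertex comes after a neighbour of the last one, P closes up to a cycle
    through almost all these neighbours; otherwise two disjoint paths
    between the initial and the final stretch of P, obtained from a version of
    Menger's theorem that prescribes the ends ([two_disjoint_paths]), give an
    even longer cycle.  So if the last vertex y of P is chosen with the largest
    possible degree, all longest paths that end at y start at a vertex of degree
    exactly t ([exists_end]).

    The vertices that precede on P the t neighbours of the first vertex are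
    first vertices of rotated longest paths.  Hence they have degree t and form
    an independent set L, so that no two neighbours of the first vertex are
    consecutive on P.  On the other hand all neighbours lie among the first
    2t + 1 vertices, for P would otherwise close up to a long cycle.  There is
    therefore almost no freedom: either all of L has the same t neighbours
    ([bipartite_core]), or the neighbourhoods of L share t - 1 vertices and each
    contains in addition exactly one of two adjacent vertices a and b
    ([split_core_of_long]).  Routing cycles through these nearly complete
    bipartite graphs leaves no room outside: apart from at most one edge in the
    first case, everything outside the core is independent and attached like L
    ([bipartite_core_structure], [split_core_structure]).  For graphs of this
    shape the required number of edges follows from Turan's theorem applied to
    the t common neighbours, which contain no clique on s + 1 vertices
    ([structure_bound]). *)

Set Implicit Arguments.
Unset Strict Implicit.

(** * Two disjoint paths between two vertex sets *)

Section Menger.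
Variables (V : finType) (e : rel V).
Implicit Types (A B : {set V}) (p q : seq V).

(** The conditions on an A-B path that survive when an initial part is cut
    off: this is what a path must provide to be appended to another one. *)
Definition b_tail A B x p : Prop :=
  [/\ path e x p, uniq (x :: p), {in p, forall v, v \notin A}
    & last x p \in B /\ {in x :: p, forall v, v \in B -> v = last x p}].

Definition ab_path A B x p : Prop := x \in A /\ b_tail A B x p.

Definition disj_paths x p y q := {in x :: p, forall v, v \notin y :: q}.

Lemma disj_pathsC x p y q : disj_paths x p y q -> disj_paths y q x p.
Proof. by move=> d v vq; apply: contraL vq => /d. Qed.

Lemma ab_path_of_path A B (D : pred V) x p :
    path e x p -> x \in A -> last x p \in B -> all D (x :: p) ->
  exists x' p', ab_path A B x' p' /\ all D (x' :: p').
Proof.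
move: {2}(size p) (leqnn (size p)) => n.
elim: n x p => [|n IHn] x p sz_p px xA lB Dp.
  case: p sz_p px lB Dp => // _ _ xB Dx; exists x, [::].
  by split=> //; split=> //; split=> //; split=> // v; rewrite inE => /eqP.
have [/hasP[v vp vA]|/hasPn noA] := boolP (has [in A] p).
  case/splitPr: p / vp sz_p px lB Dp => p1 p2 sz px lB Dp.
  move: px lB Dp; rewrite cat_path last_cat /= all_cat /= => /and3P[_ _ pv] lB /and4P[_ _ Dv Dp2].
  apply: (IHn v p2) => //=; last by rewrite Dv.
  by move: sz; rewrite size_cat /=; lia.
have [/hasP[v vp /andP[vB vl]]|/hasPn noB] :=
    boolP (has [pred v | v \in B & v != last x p] (x :: p)).
  case/splitPl: p / vp sz_p px lB Dp noA vl => p1 p2 lv sz px lB Dp noA.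
  case: p2 => [|w p2] in sz px lB Dp noA *; first by rewrite cats0 lv eqxx.
  move=> _; apply: (IHn x p1) => //.
  - by move: sz; rewrite size_cat /=; lia.
  - by move: px; rewrite cat_path => /andP[].
  - by rewrite lv.
  - by move: Dp; rewrite /= all_cat => /and3P[-> ->].
case/shortenP: px lB noB => p' px' u' sub_p lB noB.
have sub_xp : {subset x :: p' <= x :: p}.
  by move=> v; rewrite !inE => /predU1P[->|/sub_p->]; rewrite ?eqxx ?orbT.
exists x, p'; split; last by apply/allP=> v /sub_xp; apply/allP.
split=> //; split=> //; first by move=> v /sub_p/noA.
split=> // v /sub_xp /noB /=; rewrite negb_and negbK => /orP[/negP|/eqP] //.
Qed.

Lemma b_tail_suffix A B x p1 p2 :
  b_tail A B x (p1 ++ p2) -> b_tail A B (last x p1) p2.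
Proof.
case; rewrite cat_path last_cat -cat_cons cat_uniq => /andP[_ p2P].
case/and3P=> _ /hasPn dis u2 notA [lB onlyB]; split=> //.
- by rewrite /= u2 andbT; apply/negP=> /dis; rewrite /= mem_last.
- by move=> v vp; apply: notA; rewrite mem_cat vp orbT.
split=> // v; rewrite inE => /predU1P[->|vp] vB; apply: onlyB => //.
  by rewrite mem_cat mem_last.
by rewrite mem_cat vp orbT.
Qed.

(** Enlarging B to B' makes paths shorter.  The end of an A-B' path is then
    prolonged inside B', which the path itself meets in its last vertex only. *)
Lemma ab_path_extend A B B' x q s :
    ab_path A B' x q -> B \subset B' -> b_tail A B (last x q) s ->
    {subset s <= B'} -> ab_path A B x (q ++ s).
Proof.
case=> xA [px ux nA [lB' onlyB']] /subsetP sBB' [ps us nAs [lB onlyB]] ssB'.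
split=> //; split.
- by rewrite cat_path px.
- rewrite -cat_cons cat_uniq ux; move: us; rewrite cons_uniq => /andP[nl us]; rewrite us andbT /=.
  apply/hasPn=> v vs; apply/negP=> vq; case/negP: nl.
  by rewrite -(onlyB' v) // ssB'.
- by move=> v; rewrite mem_cat => /orP[/nA|/nAs].
rewrite last_cat; split=> // v; rewrite -cat_cons mem_cat => /orP[vq|vs] vB.
  have vl: v = last x q by apply: onlyB' => //; apply: sBB'.
  by apply: onlyB => //; rewrite -vl mem_head.
by apply: onlyB => //; rewrite inE vs orbT.
Qed.

Lemma disj_paths_extend A B' x q s y r s' :
    ab_path A B' x q -> ab_path A B' y r -> disj_paths x q y r ->
    {subset s <= B'} -> {subset s' <= B'} ->
    {in s, forall v, v \notin s'} -> last x q \notin s' -> last y r \notin s ->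
  disj_paths x (q ++ s) y (r ++ s').
Proof.
case=> _ [_ _ _ [_ onlyx]] [_ [_ _ _ [_ onlyy]]] dis sB' s'B' dss' xs' ys v.
rewrite -!cat_cons !mem_cat => /orP[vq|vs]; rewrite negb_or.
  rewrite dis //=; apply: contra xs' => vs'.
  by rewrite -(onlyx v) // s'B'.
rewrite dss' // andbT; apply: contra ys => vr.
by rewrite -(onlyy v) // sB'.
Qed.

Lemma split_last_has (D : pred V) y r : has D (y :: r) ->
  exists r1 r2, [/\ r = r1 ++ r2, D (last y r1) & ~~ has D r2].
Proof.
elim: r y => [|z r IHr] y; first by rewrite /= orbF => Dy; exists [::], [::].
have [/IHr[r1 [r2 [-> Dl nD]]] _|nD] := boolP (has D (z :: r)).
  by exists (z :: r1), r2.
by rewrite [has _ _]/= -/(has D (z :: r)) (negPf nD) orbF => Dy; exists [::], (z :: r).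
Qed.

(** Menger's theorem for two paths, following Bohme, Goring and Harant.  The
    given path fixes one of the ends on each side, which is the point: a cycle
    can then be routed through chosen vertices.  The induction enlarges B: if
    a second path R, avoiding the end of the first path P, meets P for the
    last time in x, then all of P and R beyond x is added to B.  Two disjoint
    paths to the larger set, one of them ending in x, can be prolonged along
    these two pieces. *)
Lemma two_disjoint_paths A B a p :
    (forall v, exists x q, ab_path A B x q /\ v \notin x :: q) ->
    ab_path A B a p ->
  exists x q y r, [/\ ab_path A B x q, ab_path A B y r, disj_paths x q y r,
    a \in [:: x; y] & last x q = last a p].
Proof.
move: {2}_.+1 (ltnSn #|~: B|) => n.
elim: n B p => // n IHn B p szB sepAB Pab.
have [aA [pp up nAp [lB onlyB]]] := Pab.
(* The second path avoids the end of the first one. *)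
have [y [r [Rab bR]]] := sepAB (last a p).
have [hasR|/hasPn nR] := boolP (has [in a :: p] (y :: r)); last first.
  by exists a, p, y, r; split; rewrite ?mem_head //; apply: disj_pathsC.
have [r1 [r2 [rr xp /hasPn nr2]]] := split_last_has hasR.
set x := last y r1 in xp.
have xr : x \in y :: r by rewrite rr -cat_cons mem_cat mem_last.
have nxb : x != last a p by apply: contraNneq bR => <-.
have xB : x \notin B by apply: contraNN nxb => /(onlyB x xp)->.
have tR : b_tail A B x r2 by apply: b_tail_suffix; case: Rab; rewrite rr.
case/splitPl def_p: p / xp => [p1 p2 lx].
have tP : b_tail A B x p2 by rewrite -lx; apply: b_tail_suffix; rewrite -def_p.
have lp2 : last x p2 = last a p by rewrite def_p last_cat lx.
(* B together with the parts of the two paths from x on, where x is the last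
   vertex of the second path on the first. *)
pose B' := x |: B :|: [set v in p2] :|: [set v in r2].
have sBB' : B \subset B' by apply/subsetP=> v vB; rewrite !inE vB orbT.
have xB' : x \in B' by rewrite !inE eqxx.
have sp2 : {subset p2 <= B'} by move=> v vp; rewrite !inE vp !orbT.
have sr2 : {subset r2 <= B'} by move=> v vp; rewrite !inE vp !orbT.
have dpr : {in p2, forall v, v \notin r2}.
  move=> v vp; apply/negP=> /nr2; rewrite /= inE def_p mem_cat vp !orbT //.
have nxp2 : x \notin p2 by case: tP => _ /andP[].
have nxr2 : x \notin r2 by case: tR => _ /andP[].
have Pab' : ab_path A B' a p1.
  split=> //; split.
  - by move: pp; rewrite def_p cat_path => /andP[].
  - by move: up; rewrite def_p -cat_cons cat_uniq => /andP[].
  - by move=> v vp; apply: nAp; rewrite def_p mem_cat vp.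
  rewrite lx; split=> // v vp; rewrite !inE -!orbA => /or4P[/eqP-> //|vB|vp2|vr2].
  - have vl: v = last a p by apply: onlyB; rewrite // def_p -cat_cons mem_cat vp.
    have: last a p \in x :: p2 by rewrite -lp2 mem_last.
    rewrite -vl inE => /predU1P[//|vp2].
    move: up; rewrite def_p -cat_cons cat_uniq => /and3P[_ /hasPn/(_ v vp2)].
    by rewrite /= vp.
  - move: up; rewrite def_p -cat_cons cat_uniq => /and3P[_ /hasPn/(_ v vp2)].
    by rewrite /= vp.
  - by case/negP: (nr2 _ vr2); rewrite /= def_p -cat_cons mem_cat vp.
have sep' v : exists x q, ab_path A B' x q /\ v \notin x :: q.
  have [x1 [q1 [[x1A [q1p q1u nA1 [l1 o1]]] vq]]] := sepAB v.
  have [||x2 [q2 [Q2 D2]]] := @ab_path_of_path A B' (predC1 v) x1 q1 q1p x1A.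
  - by apply: (subsetP sBB').
  - by apply/allP=> w wq /=; apply: contraNneq vq => <-.
  by exists x2, q2; split=> //; apply/negP=> /(allP D2) /=; rewrite eqxx.
have szB' : #|~: B'| < n.
  suff h: #|~: B'| < #|~: B| by apply: leq_trans h szB.
  apply: proper_card; rewrite properE setCS sBB' /= setCS.
  by apply/negP=> /subsetP/(_ x xB'); rewrite (negPf xB).
have [x1 [q1 [y1 [s1 [Q1 S1 dis a1]]]]] := IHn B' p1 szB' sep' Pab'.
rewrite lx => lq1.
set w := last y1 s1.
have wB' : w \in B' by case: S1 => _ [_ _ _ []].
have nwx : w != x.
  apply/negP=> /eqP wx; have := dis x; rewrite -{1}lq1 mem_last.
  by rewrite -wx mem_last => /(_ isT).
pose dis' s s' := disj_paths_extend Q1 S1 dis (s := s) (s' := s').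
(* One of the new paths ends in x, the other in w.  Depending on the piece that
   contains w, the path ending in x is prolonged along the other piece. *)
have [wp2|nwp2] := boolP (w \in p2).
  have wxp2 : w \in x :: p2 by rewrite inE wp2 orbT.
  have nwr2 := dpr _ wp2.
  case/splitPl: {2}p2 / (wxp2) (erefl p2) => p21 p22 lw defp2.
  have tw : b_tail A B w p22 by rewrite -lw; apply: b_tail_suffix; rewrite -defp2.
  have sp22 : {subset p22 <= p2} by move=> v vp; rewrite defp2 mem_cat vp orbT.
  exists y1, (s1 ++ p22), x1, (q1 ++ r2); split.
  - by apply: ab_path_extend sBB' tw _ => // v /sp22/sp2.
  - by apply: ab_path_extend sBB' _ _ => //; rewrite lq1.
  - apply/disj_pathsC/dis' => //; rewrite ?lq1 //.
    + by move=> v /sp22/sp2.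
    + by move=> v vr; apply: contraL vr => /sp22/dpr.
    + by apply: contra nxp2 => /sp22.
  - by move: a1; rewrite !inE orbC.
  - by rewrite last_cat -/w -def_p -lp2 defp2 last_cat lw.
have [wr2|nwr2] := boolP (w \in r2).
  have wxr2 : w \in x :: r2 by rewrite inE wr2 orbT.
  case/splitPl: {2}r2 / (wxr2) (erefl r2) => r21 r22 lw defr2.
  have tw : b_tail A B w r22 by rewrite -lw; apply: b_tail_suffix; rewrite -defr2.
  have sr22 : {subset r22 <= r2} by move=> v vp; rewrite defr2 mem_cat vp orbT.
  exists x1, (q1 ++ p2), y1, (s1 ++ r22); split=> //.
  - by apply: ab_path_extend sBB' _ _ => //; rewrite lq1.
  - by apply: ab_path_extend sBB' tw _ => // v /sr22/sr2.
  - apply/dis' => //; rewrite ?lq1 //.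
    + by move=> v /sr22/sr2.
    + by move=> v /dpr; apply: contra => /sr22.
    + by apply: contra nxr2 => /sr22.
  - by rewrite last_cat lq1 -def_p.
have wB : w \in B by move: wB'; rewrite !inE (negPf nwx) (negPf nwp2) (negPf nwr2) !orbF.
have tw : b_tail A B w [::].
  by split=> //; split=> // v; rewrite inE => /eqP.
exists x1, (q1 ++ p2), y1, (s1 ++ [::]); split=> //.
- by apply: ab_path_extend sBB' _ _ => //; rewrite lq1.
- by apply: ab_path_extend sBB' tw _.
- by apply/dis'.
- by rewrite last_cat lq1 -def_p.
Qed.

End Menger.

(** * Building cycles from paths; longest paths *)

Section Cycles.

Lemma uniq_tail (T : eqType) (x : T) s : uniq (x :: s) -> uniq s.
Proof. by case/andP. Qed.

Lemma mem_drop_index (T : eqType) (s : seq T) i v :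
  uniq s -> v \in s -> (v \in drop i s) = (i <= index v s).
Proof.
move=> us vs; rewrite leqNgt -(in_take i vs).
move: us vs; rewrite -{1 2}(cat_take_drop i s) cat_uniq mem_cat => /and3P[_ /hasPn dis _].
case: (boolP (v \in drop i s)) => [/dis/negPf /= -> //|_].
by rewrite orbF => ->.
Qed.

Lemma mem_slice (T : eqType) (s : seq T) h k v : uniq s -> v \in s ->
  (v \in drop h (take k s)) = (h <= index v s < k).
Proof.
move=> us vs; rewrite -(in_take k vs).
have [vk|vk] := boolP (v \in take k s); last first.
  by rewrite andbF; apply: contraNF vk; apply: mem_drop.
rewrite mem_drop_index ?take_uniq // andbT.
by rewrite -[in RHS](cat_take_drop k s) index_cat vk.
Qed.

Variables (V : finType) (e : rel V).
Hypothesis (e_sym : symmetric e) (e_irr : irreflexive e).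
Implicit Types (A B Q : {set V}) (p q s : seq V).

Lemma path_rev a p : path e a p -> uniq (a :: p) ->
  exists q, [/\ path e (last a p) q, uniq (last a p :: q), last (last a p) q = a,
                size q = size p & last a p :: q =i a :: p].
Proof.
move=> pp up; exists (rev (belast a p)).
have E : last a p :: rev (belast a p) = rev (a :: p).
  by rewrite (lastI _ p) rev_rcons.
split.
- by rewrite rev_path; rewrite (eq_path (e' := e)).
- by rewrite E rev_uniq.
- by case: p {pp up E} => //= b p; rewrite rev_cons last_rcons.
- by rewrite size_rev size_belast.
- by move=> v; rewrite E mem_rev.
Qed.

Lemma glue_cycle a p q :
    path e a p -> path e a q -> last a p = last a q ->
    uniq (a :: p) -> uniq (a :: q) -> 0 < size q ->
    {in p, forall v, v \in q -> v = last a q} ->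
  exists c, [/\ cycle e c, uniq c & size c = size p + size q].
Proof.
case/lastP: q => // q b pp pq; rewrite last_rcons => lp up uq _ int.
exists (a :: p ++ rev q); split.
- rewrite /= rcons_cat cat_path pp lp -rev_cons.
  have := rev_path e a (rcons q b); rewrite last_rcons belast_rcons => ->.
  by rewrite (eq_path (e' := e)).
- rewrite -cat_cons cat_uniq up rev_uniq.
  move: uq; rewrite /= rcons_uniq mem_rcons inE negb_or => /and3P[/andP[_ aq] bq ->].
  rewrite andbT; apply/hasPn=> v; rewrite mem_rev => vq; rewrite inE negb_or.
  apply/andP; split; first by apply: contraNneq aq => <-.
  by apply: contra bq => vp; rewrite -(int v vp) // mem_rcons inE vq orbT.
- by rewrite /= size_cat size_rev size_rcons addnS.
Qed.

Definition conn Q a b k := exists z,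
  [/\ path e a z, uniq (a :: z), last a z = b, {subset a :: z <= Q} & k <= size z].

Lemma conn_sym Q a b k : conn Q a b k -> conn Q b a k.
Proof.
case=> z [pz uz lz sz kz]; have [z'] := path_rev pz uz.
rewrite lz => -[pz' uz' lz' szz' eqz]; exists z'; split=> //; last by rewrite szz'.
by move=> v; rewrite eqz => /sz.
Qed.

(** The two halves of the cycle lead from x to the last vertex of r: one
    crosses A and follows r, the other follows q and crosses B.  They could
    only meet inside A and B, which the last hypothesis excludes. *)
Lemma link_cycle A B x q y r k1 k2 :
    ab_path e A B x q -> ab_path e A B y r -> disj_paths x q y r ->
    conn A x y k1 -> conn B (last x q) (last y r) k2 ->
    {subset A :&: B <= x :: q} ->
  exists c, [/\ cycle e c, uniq c & k1 + k2 + size q + size r <= size c].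
Proof.
move=> [xA [pq uq qA [lqB qB]]] [yA [pr ur rA [lrB rB]]] dis.
move=> [z1 [pz1 uz1 lz1 sz1 k1z1]] [z2 [pz2 uz2 lz2 sz2 k2z2]] sAB.
have yqN : y \notin x :: q by apply: contraL (mem_head y r) => /dis.
have lN : last y r \notin x :: q by apply: contraL (mem_last y r) => /dis.
have z2q v : v \in z2 -> v \notin x :: q.
  move=> vz2; apply/negP=> vq; case/andP: uz2 => /negP[].
  by rewrite -(qB v) // sz2 // inE vz2 orbT.
have rx v : v \in r -> v \notin x :: q.
  by move=> vr; apply/negP=> /dis; rewrite inE vr orbT.
have [|||||||c [cc uc szc]] := @glue_cycle x (z1 ++ r) (q ++ z2).
- by rewrite cat_path pz1 lz1.
- by rewrite cat_path pq.
- by rewrite !last_cat lz1 lz2.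
- rewrite -cat_cons cat_uniq uz1 (uniq_tail ur) andbT; apply/hasPn=> v vr /=.
  by apply: contra (rA _ vr) => /sz1.
- rewrite -cat_cons cat_uniq uq (uniq_tail uz2) andbT; apply/hasPn=> v vr /=.
  exact: z2q.
- rewrite size_cat addn_gt0; case: (z2) lz2 => [/= E|*]; last by rewrite orbT.
  by move: lN; rewrite -E mem_last.
- move=> v; rewrite !mem_cat last_cat lz2 => /orP[vz1|vr] /orP[vq|vz2].
  + by case/negP: (qA v vq); apply: sz1; rewrite inE vz1 orbT.
  + case/negP: (z2q v vz2); apply: sAB; rewrite inE.
    by rewrite sz1 ?sz2 // inE ?vz1 ?vz2 orbT.
  + by case/negP: (rx v vr); rewrite inE vq orbT.
  + by apply: rB; [rewrite inE vr orbT | apply: sz2; rewrite inE vz2 orbT].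
exists c; split=> //; rewrite szc !size_cat.
by move: k1z1 k2z2; clear; lia.
Qed.

(** The absence of a cut vertex in terms of edges leaving a set; a violation
    of this form splits the vertex set into two parts that share only v, which
    suits the induction on edges.  It also implies connectedness when there
    are at least three vertices. *)
Definition no_cutvertex := forall v (S : {set V}),
  v \notin S -> S != set0 -> v |: S != setT ->
  exists x y, [/\ x \in S, y \notin v |: S & e x y].

Hypothesis cutfree : no_cutvertex.

Lemma ab_path_avoid A B v :
    (exists2 a, a \in A & a != v) -> (exists2 b, b \in B & b != v) ->
  exists x q, ab_path e A B x q /\ v \notin x :: q.
Proof.
case=> a aA av [b bB bv].
pose ev := [rel x y | [&& e x y, x != v & y != v]].
have evP x p : x != v -> path ev x p -> path e x p && all (predC1 v) (x :: p).
  elim: p x => [|y p IHp] x xv /=; first by rewrite xv.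
  by case/andP=> /and3P[-> _ yv] /(IHp y yv) /= /and3P[-> -> ->]; rewrite xv.
have [ab|nab] := boolP (connect ev a b).
  have [p /(evP _ _ av)/andP[pp Dp] lp] := connectP ab.
  rewrite lp in bB; have [x [q [Q D]]] := ab_path_of_path pp aA bB Dp.
  by exists x, q; split=> //; apply/negP=> /(allP D) /=; rewrite eqxx.
pose S := [set w | connect ev a w].
have vS : v \notin S.
  rewrite inE; apply/negP=> /connectP[p /(evP _ _ av)/andP[_ /allP D] lp].
  by move: (D v); rewrite /= {1}lp mem_last eqxx => /(_ isT).
case: (cutfree vS).
- by apply/set0Pn; exists a; rewrite inE connect0.
- by apply: contraNneq nab => /setP/(_ b); rewrite !inE (negPf bv).
move=> x [y []]; rewrite !inE negb_or => ax /andP[yv ay] exy.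
case/negP: ay; apply: (connect_trans ax); apply: connect1 => /=.
by rewrite exy yv andbT; apply: contraNneq vS => <-; rewrite inE.
Qed.

Definition longest_path x p :=
  [/\ path e x p, uniq (x :: p) &
      forall y q, path e y q -> uniq (y :: q) -> size q <= size p].

Variable N : nat.
Hypothesis circ : forall c, cycle e c -> uniq c -> size c <= N.
Hypothesis card_gt : N < #|V|.

(** A cycle does not cover all vertices, so some edge leaves it; entering the
    cycle along that edge and running around it gives a path with as many
    edges as the cycle has vertices. *)
Lemma cycle_lt_longest x p c :
  longest_path x p -> cycle e c -> uniq c -> 1 < size c -> size c <= size p.
Proof.
case=> _ _ maxp cc uc szc.
have [w wc] : exists w, w \in ~: [set v in c].
  apply/set0Pn; rewrite -card_gt0 cardsCs setCK subn_gt0.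
  by rewrite cardsE (card_uniqP uc); apply: leq_ltn_trans (circ cc uc) card_gt.
pose v0 := nth x c 0; pose v1 := nth x c 1.
have v0c : v0 \in c by apply: mem_nth; apply: ltnW.
have v1c : v1 \in c by apply: mem_nth.
have v01 : v1 != v0 by rewrite nth_uniq // ltnW.
case: (@cutfree v0 (~: [set v in c])).
- by rewrite !inE negbK.
- by apply/set0Pn; exists w.
- by apply/negP=> /eqP/setP/(_ v1); rewrite !inE v1c (negPf v01).
move=> a [b []]; rewrite !inE negb_or negbK => ac /andP[_ bc] eab.
have [i c' Ec] := rot_to bc.
have szc' : size c = size (b :: c') by rewrite -Ec size_rot.
rewrite szc'; apply: (maxp a (b :: c')).
  have: cycle e (b :: c') by rewrite -Ec rot_cycle.
  by rewrite /= rcons_path eab => /andP[].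
by rewrite cons_uniq -Ec mem_rot ac rot_uniq.
Qed.

Lemma longest_nbr x p : longest_path x p -> forall w, e x w -> w \in x :: p.
Proof.
case=> pp up maxp w xw; apply: contraT => wp.
have := maxp w (x :: p); rewrite /= e_sym xw pp -/(uniq (x :: p)) wp up.
by move=> /(_ isT isT); rewrite ltnn.
Qed.

Lemma longest_rev x p : longest_path x p ->
  exists q, [/\ longest_path (last x p) q, last (last x p) q = x,
     size q = size p & last x p :: q = rev (x :: p)].
Proof.
move=> [pp up maxp]; exists (rev (belast x p)).
have E : last x p :: rev (belast x p) = rev (x :: p) by rewrite (lastI _ p) rev_rcons.
split=> //; last by rewrite size_rev size_belast.
- split; rewrite ?size_rev ?size_belast //; last by rewrite E rev_uniq.
  by rewrite rev_path; rewrite (eq_path (e' := e)).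
- by case: p {pp up maxp E} => //= b p; rewrite rev_cons last_rcons.
Qed.

End Cycles.

(** * The degree sum of the ends of a longest path *)

Section Dirac.
Variables (V : finType) (e : rel V).
Hypothesis (e_sym : symmetric e) (e_irr : irreflexive e).
Implicit Types (A B Q : {set V}) (p q s : seq V).

Definition nbr v := [set w | e v w].

(** Let b be the last neighbour of x on the path.  From any u before b, walk
    back to x, jump to the first neighbour of x beyond u, and walk on to b:
    only vertices that are not adjacent to x have been skipped. *)
Lemma conn_covering_nbrs x p b u (s := x :: p) :
    path e x p -> uniq s -> e x b -> b \in s ->
    (forall w, e x w -> w \in s /\ index w s <= index b s) ->
    u \in s -> index u s < index b s ->
  conn e [set v in s | index v s <= index b s] u b #|nbr x|.
Proof.
move=> pp us xb bs nbs uS; set i := index u s; set k := index b s => ik.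
have ks : k < size s by rewrite index_mem.
have ex_h : exists h, (i < h) && e x (nth x s h).
  by exists k; rewrite ik nth_index.
case: (ex_minnP ex_h) => h /andP[ih xh] h_min.
have hk : h <= k by apply: h_min; rewrite ik nth_index.
have Ei : rev (take i.+1 s) = u :: rev (take i s).
  by rewrite (take_nth x) ?(ltn_trans ik) // nth_index // rev_rcons.
have Ek : drop h (take k.+1 s) = rcons (drop h (take k s)) b.
  rewrite (take_nth x) // nth_index // drop_rcons // size_take ks //.
have ss : sorted e s by [].
have inz v : v \in u :: (rev (take i s) ++ drop h (take k.+1 s)) =
    (v \in s) && ((index v s <= i) || (h <= index v s <= k)).
  rewrite -cat_cons -Ei mem_cat mem_rev.
  have [vs|vs] := boolP (v \in s); last first.
    apply/norP; split; first by apply: contra vs; apply: mem_take.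
    by apply: contra vs => /mem_drop/mem_take.
  by rewrite in_take // mem_slice.
exists (rev (take i s) ++ drop h (take k.+1 s)); split.
- rewrite cat_path.
  have: sorted e (rev (take i.+1 s)).
    by rewrite rev_sorted (eq_sorted (e' := e)) ?take_sorted.
  rewrite Ei [sorted _ _]/= => ->; rewrite andTb.
  have -> : last u (rev (take i s)) = x.
    case: (posnP i) => [i0|].
      by rewrite i0 take0 /= -(nth_index x uS) -/i i0.
    by case: (i) => // i' _; rewrite /= rev_cons last_rcons.
  have hs : h < size (take k.+1 s) by rewrite size_take; case: (ltnP k.+1 (size s)) => _; [exact: hk | exact: leq_ltn_trans hk ks].
  have := drop_sorted h (take_sorted k.+1 ss).
  rewrite (drop_nth x hs) nth_take // => sd.
  by apply/andP; split; [exact: xh | exact: sd].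
- rewrite -[uniq _]/(uniq ((u :: rev (take i s)) ++ _)) -Ei cat_uniq rev_uniq take_uniq // drop_uniq ?take_uniq // andbT.
  apply/hasPn=> v vd; rewrite mem_rev.
  have vs : v \in s by apply: mem_take (mem_drop vd).
  move: vd; rewrite in_take // -leqNgt mem_slice // => /andP[hv _].
  exact: leq_trans ih hv.
- by rewrite Ek last_cat last_rcons.
- move=> v; rewrite inz in_set => /andP[-> /=] /orP[vi|/andP[_ ->//]].
  by apply: leq_trans vi (ltnW ik).
- rewrite -ltnS -[(size _).+1]/(size (u :: _)).
  have -> : #|nbr x|.+1 = size (x :: enum (nbr x)) by rewrite /= -cardE.
  apply: uniq_leq_size => [|v].
    by rewrite cons_uniq enum_uniq mem_enum inE e_irr.
  rewrite inz in_cons mem_enum in_set => /predU1P[->|xv].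
    by rewrite mem_head /= eqxx.
  have [vs vk] := nbs v xv; rewrite vs vk andbT /=.
  by case: (leqP (index v s) i) => //= iv; apply: h_min; rewrite iv nth_index.
Qed.

Lemma last_take_nth x p j : j <= size p -> last x (take j p) = nth x (x :: p) j.
Proof.
move=> jp; rewrite (last_nth x) size_takel // -[x :: take j p]/(take j.+1 (x :: p)).
by rewrite nth_take.
Qed.

Lemma crossing_cycle x p i j (s := x :: p) :
    path e x p -> uniq s -> j < i < size s ->
    e x (nth x s i) -> e (last x p) (nth x s j) ->
  exists c, [/\ cycle e c, uniq c & size c = j + (size s - i) + 1].
Proof.
move=> pp us /andP[ji im] xi yj; set z := nth x s i.
have jp : j <= size p by apply: leq_trans (ltnW ji) _.
have Ed : drop i s = z :: drop i.+1 s by apply: drop_nth.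
have lz : last z (drop i.+1 s) = last x p.
  have := congr1 (last x) (cat_take_drop i s); rewrite last_cat Ed /= => <- //.
have Er : rev (drop i s) = last x p :: rev (belast z (drop i.+1 s)).
  by rewrite Ed lastI rev_rcons lz.
have pr : path e (last x p) (rev (belast z (drop i.+1 s))).
  rewrite -lz rev_path (eq_path (e' := e)) //.
  by have: sorted e (drop i s) by [apply: drop_sorted]; rewrite Ed.
have [|||||||c [cc uc sc]] := @glue_cycle V e e_sym x (take j p ++ rev (drop i s)) [:: z].
- rewrite cat_path; have := pp; rewrite -{1}(cat_take_drop j p) cat_path.
  case/andP=> -> _; rewrite last_take_nth // Er /= pr andbT e_sym; exact: yj.
- by rewrite /= xi.
- by rewrite last_cat Ed rev_cons last_rcons.
- rewrite -[x :: _]/(take j.+1 s ++ rev (drop i s)) cat_uniq take_uniq // rev_uniq.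
  rewrite drop_uniq // andbT; apply/hasPn=> v; rewrite mem_rev => vd.
  have vs := mem_drop vd; rewrite in_take // -leqNgt; apply: leq_trans ji _.
  by rewrite -mem_drop_index.
- by rewrite /= inE andbT -{1}[x]/(nth x s 0) nth_uniq //; case: (i) ji.
- by [].
- by move=> v _; rewrite inE => /eqP.
exists c; split=> //; rewrite sc size_cat size_rev size_drop size_takel //.
Qed.

Hypothesis cutfree : no_cutvertex e.
Variable N : nat.
Hypothesis circ : forall c, cycle e c -> uniq c -> size c <= N.
Hypothesis card_gt : N < #|V|.

Lemma index_rev_uniq (s : seq V) v : uniq s -> v \in s ->
  index v (rev s) = size s - (index v s).+1.
Proof.
move=> us vs; have vl : index v s < size s by rewrite index_mem.
have vr : size s - (index v s).+1 < size s by move: vl; clear; lia.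
rewrite -{1}(nth_index v vs) -[index v s in LHS](_ : size s - (size s - (index v s).+1).+1 = _).
  by rewrite -nth_rev // index_uniq ?size_rev ?rev_uniq.
by move: vl; clear; lia.
Qed.

Lemma index_ltn_neq (s : seq V) u b : u \in s -> u != b ->
  index u s <= index b s -> index u s < index b s.
Proof.
move=> us ub; rewrite leq_eqVlt => /orP[/eqP E|//].
have bs : b \in s by rewrite -index_mem -E index_mem.
by case/eqP: ub; apply: (index_inj u us bs).
Qed.

(** Choose a neighbour u of the last vertex and a later neighbour w of the
    first one at minimal distance.  The cycle that runs from x to u, jumps to
    the end, runs back to w and returns to x misses only vertices between u
    and w, where by minimality there are no further neighbours of x or of the
    last vertex.  No neighbour of x is the successor of a neighbour of the
    last vertex, as that would give a cycle through the whole path; hence the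
    neighbours of x and the successors of the neighbours of the last vertex
    are counted separately. *)
Lemma crossing_degree_sum x p u w (s := x :: p) :
    longest_path e x p -> e (last x p) u -> e x w -> index u s < index w s ->
  #|nbr x| + #|nbr (last x p)| <= N.
Proof.
move=> lp yu xw uw; have [pp us _] := lp.
have nbx := longest_nbr e_sym lp; rewrite -/s in nbx us.
have nby v : e (last x p) v -> v \in s.
  have [q [lq _ _ Eq]] := longest_rev e_sym lp.
  by move/(longest_nbr e_sym lq); rewrite Eq mem_rev.
have cross i j := @crossing_cycle x p i j pp us; rewrite -/s in cross.
have s0 : nth x s 0 = x by [].
have sl : nth x s (size p) = last x p by rewrite (last_nth x).
have sz_s : size s = (size p).+1 by [].
clearbody s.
pose P := [pred a : V * V | [&& e (last x p) a.1, e x a.2 & index a.1 s < index a.2 s]].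
have Puw : P (u, w) by rewrite /= yu xw.
case: (arg_minnP (fun a : V * V => index a.2 s - index a.1 s) Puw) => -[u' w'] /=.
move=> {u w yu xw uw Puw} /and3P[yu xw uw] minP; set j := index u' s; set i := index w' s.
have xgap v : e x v -> (index v s <= j) || (i <= index v s).
  move=> xv; case: leqP => //= jv; rewrite leqNgt; apply/negP=> vi.
  have := minP (u', v); rewrite /= yu xv jv => /(_ isT).
  by rewrite -/i -/j; move: jv vi; clear; lia.
have ygap v : e (last x p) v -> (index v s <= j) || (i <= index v s).
  move=> yv; case: leqP => //= jv; rewrite leqNgt; apply/negP=> vi.
  have := minP (v, w'); rewrite /= yv xw vi => /(_ isT).
  by rewrite -/i -/j; move: jv vi; clear; lia.
have im : i < size s by rewrite index_mem nbx.
have fi : e x (nth x s i) by rewrite nth_index // nbx.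
have fj : e (last x p) (nth x s j) by rewrite nth_index // nby.
have ji : j < i < size s by rewrite uw.
have [c [cc uc sc]] := cross i j ji fi fj.
apply: leq_trans (circ cc uc); rewrite sc.
have iN v : e x v -> forall v', e (last x p) v' -> index v s != (index v' s).+1.
  move=> xv v' yv'; apply/eqP=> E.
  have fv : e x (nth x s (index v s)) by rewrite nth_index // nbx.
  have fv' : e (last x p) (nth x s (index v' s)) by rewrite nth_index // nby.
  have vv' : index v' s < index v s < size s by rewrite E leqnn -E index_mem nbx.
  have [c' [cc' uc' sc']] := cross (index v s) (index v' s) vv' fv fv'.
  have := cycle_lt_longest cutfree circ card_gt lp cc' uc'.
  have vm : index v s < (size p).+1 by rewrite -sz_s index_mem nbx.
  by rewrite sc' E sz_s; move: vm; rewrite E; clear; lia.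
(* Count positions: 0, those of the neighbours of x, and the successors of
   those of the neighbours of the last vertex other than u'. *)
pose l1 := [seq index v s | v <- enum (nbr x)].
pose l2 := [seq (index v s).+1 | v <- enum (nbr (last x p) :\ u')].
have sl1 : size l1 = #|nbr x| by rewrite size_map -cardE.
have sl2 : (size l2).+1 = #|nbr (last x p)|.
  by rewrite size_map -cardE [RHS](cardsD1 u') inE yu.
have uniq_l : uniq (0 :: l1 ++ l2).
  have injx : {in enum (nbr x) &, injective (index^~ s)}.
    by move=> a b; rewrite !mem_enum !inE => /nbx as_ /nbx bs; apply: (index_inj a).
  have injy : {in enum (nbr (last x p) :\ u') &, injective (fun v => (index v s).+1)}.
    move=> a b; rewrite !mem_enum !inE => /andP[_ /nby as_] /andP[_ /nby bs] [].
    by apply: (index_inj a).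
  rewrite cons_uniq cat_uniq !map_inj_in_uniq ?enum_uniq // andbT mem_cat negb_or -andbA /=.
  apply/and3P; split.
  - apply/mapP=> -[v]; rewrite mem_enum inE => xv v0.
    have: v = x by rewrite -(nth_index x (nbx v xv)) -v0.
    by move=> vx; rewrite vx e_irr in xv.
  - by apply/mapP=> -[].
  - apply/hasPn=> h /mapP[v']; rewrite mem_enum !inE => /andP[_ yv'] ->.
    apply/mapP=> -[v]; rewrite mem_enum inE => xv E.
    by case/eqP: (iN v xv v' yv').
have sub_l : {subset 0 :: l1 ++ l2 <= iota 0 j.+1 ++ iota i (size s - i)}.
  move=> h; rewrite in_cons mem_cat (mem_cat h (iota 0 _)) !mem_iota add0n (subnKC (ltnW im)) => /or3P[/eqP->//|/mapP[v]|/mapP[v]].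
    rewrite mem_enum inE => xv ->; rewrite ltnS index_mem nbx // andbT; exact: xgap.
  rewrite mem_enum !inE => /andP[vu yv] ->.
  have vs := nby v yv.
  have vj : index v s != j.
    by apply: contraNneq vu => /(index_inj x vs) -> //; apply: nby.
  have vl : (index v s).+1 < size s.
    move: vs; rewrite -index_mem leq_eqVlt => /orP[/eqP E|//].
    have: v = last x p.
      rewrite -(nth_index x (nby v yv)) -sl; congr (nth x s _).
      by move: E; rewrite sz_s => -[].
    by move=> vy; rewrite vy e_irr in yv.
  case/orP: (ygap v yv) => [vj'|iv].
    by rewrite ltnS ltn_neqAle vj vj'.
  by rewrite vl (leq_trans iv) ?orbT.
have := uniq_leq_size uniq_l sub_l.
rewrite /= !size_cat !size_iota sl1 -sl2; clear; lia.
Qed.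

(** When no neighbours cross, let b be the last neighbour of x and c the first
    neighbour of the other end y.  The stretches up to b and from c on have at
    most one vertex in common.  Two disjoint paths between them, which may be
    assumed to use b and c, are closed up by connections that cover all
    neighbours of x and of y. *)
Lemma longest_degree_sum x p :
    longest_path e x p -> (forall v, 0 < #|nbr v|) ->
  #|nbr x| + #|nbr (last x p)| <= N.
Proof.
move=> lp deg; set s := x :: p; set y := last x p.
have [[u w]|nocross] := pickP [pred a : V * V | [&& e y a.1, e x a.2 & index a.1 s < index a.2 s]].
  by case/and3P; apply: crossing_degree_sum.
have [pp us _] := lp.
have nbx := longest_nbr e_sym lp; rewrite -/s in nbx us.
have [q [lq lqx szq Eq]] := longest_rev e_sym lp.
have nby v : e y v -> v \in s by move/(longest_nbr e_sym lq); rewrite Eq mem_rev.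
have ys : y \in s by apply: mem_last.
have [b0] : exists b, b \in nbr x by apply/card_gt0P.
have [c0] : exists c, c \in nbr y by apply/card_gt0P.
rewrite !inE => yc0 xb0.
case: (@arg_maxnP _ b0 (e x) (index^~ s) xb0) => b xb maxb.
case: (@arg_minnP _ c0 (e y) (index^~ s) yc0) => c yc minc.
have [bs cs] := (nbx b xb, nby c yc).
have bc : index b s <= index c s.
  by rewrite leqNgt; apply/negP=> cb; have := nocross (c, b); rewrite /= yc xb cb.
set Q1 := [set v in s | index v s <= index b s].
set Q2 := [set v in s | index c s <= index v s].
have xne : x != b by apply: contraTneq xb => <-; rewrite e_irr.
have yne : y != c by apply: contraTneq yc => <-; rewrite e_irr.
have conn1 v : v \in Q1 -> v != b -> conn e Q1 v b #|nbr x|.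
  rewrite in_set => /andP[vs vb] nvb.
  apply: conn_covering_nbrs => //; last by apply: index_ltn_neq.
  by move=> z xz; split; [apply: nbx | apply: maxb].
have [pq uq _] := lq.
have Q2rev v : (v \in Q2) = (v \in y :: q) && (index v (y :: q) <= index c (y :: q)).
  rewrite in_set -/y Eq mem_rev; case vs: (v \in s) => //; rewrite !andTb.
  rewrite -/s !index_rev_uniq //; move: vs cs; rewrite -!index_mem.
  clearbody s; clear; move: (index v s) (index c s) (size s) => a b m h1 h2.
  by apply/idP/idP; lia.
have Q2E : Q2 = [set v in y :: q | index v (y :: q) <= index c (y :: q)].
  by apply/setP=> v; rewrite Q2rev in_set.
have conn2 v : v \in Q2 -> v != c -> conn e Q2 v c #|nbr y|.
  rewrite Q2rev Q2E => /andP[vs vc] nvc.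
  apply: conn_covering_nbrs => //; first by rewrite Eq mem_rev.
    move=> z yz; have: z \in Q2 by rewrite in_set nby // minc.
    by rewrite Q2rev => /andP[].
  by apply: index_ltn_neq.
have bm : index b s < size (take (index c s).+1 s).
  rewrite size_take; case: (ltnP (index c s).+1 _) => _; last by rewrite index_mem.
  exact: bc.
set r := drop (index b s).+1 (take (index c s).+1 s).
have Er : b :: r = drop (index b s) (take (index c s).+1 s).
  by rewrite (drop_nth x bm) nth_take // nth_index.
have lr : last b r = c.
  rewrite -[last b r]/(last b (b :: r)) Er (take_nth x) ?index_mem // nth_index //.
  by rewrite drop_rcons ?last_rcons // size_take index_mem cs.
have P0 : ab_path e Q1 Q2 b r.
  split; first by rewrite in_set bs leqnn.
  split.
  - have: sorted e (b :: r) by rewrite Er; apply/drop_sorted/take_sorted.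
    by [].
  - by rewrite Er drop_uniq ?take_uniq.
  - move=> v vr; have vs : v \in s by apply: mem_take (mem_drop vr).
    by move: vr; rewrite mem_slice // in_set vs /= -ltnNge => /andP[].
  - rewrite lr; split; first by rewrite in_set cs leqnn.
    move=> v; rewrite Er => vr; have vs : v \in s by apply: mem_take (mem_drop vr).
    move: vr; rewrite mem_slice // in_set vs andTb ltnS => /andP[_ vc] cv.
    apply: (@index_inj V x s) => //; apply/eqP; rewrite eqn_leq.
    by apply/andP; split; [exact: vc | exact: cv].
have sep v : exists x q, ab_path e Q1 Q2 x q /\ v \notin x :: q.
  apply: ab_path_avoid => //.
    have [xv|xv] := eqVneq x v; [exists b | exists x] => //.
    - by rewrite in_set bs leqnn.
    - by rewrite -xv eq_sym.
    - by rewrite in_set; apply/andP; split; [exact: mem_head | rewrite /s /= eqxx].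
  have [yv|yv] := eqVneq y v; [exists c | exists y] => //.
  - by rewrite in_set cs leqnn.
  - by rewrite -yv eq_sym.
  - rewrite in_set ys andTb.
    have -> : index y s = size p by rewrite /y (last_nth x) index_uniq.
    by have: index c s < size s by rewrite index_mem.
have [x1 [q1 [y1 [r1 [X Y dis bxy]]]]] := two_disjoint_paths sep P0.
rewrite lr => lq1.
have [x1A _] := X; have [y1A [_ _ _ [lr1B _]]] := Y.
have xy1 : y1 != x1.
  by apply/eqP=> E; have := dis y1; rewrite {1}E !mem_head => /(_ isT).
have lqr : last y1 r1 != c.
  by apply/eqP=> E; have := dis (last y1 r1); rewrite {1}E -lq1 !mem_last => /(_ isT).
have C1 : conn e Q1 x1 y1 #|nbr x|.
  move: bxy; rewrite !inE => /orP[] /eqP E.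
    by rewrite -E; apply: conn_sym => //; apply: conn1; rewrite // E.
  by rewrite -E; apply: conn1; rewrite // E eq_sym.
have C2 : conn e Q2 (last x1 q1) (last y1 r1) #|nbr y|.
  by rewrite lq1; apply: conn_sym => //; apply: conn2.
have [|d [cd ud szd]] := link_cycle e_sym X Y dis C1 C2.
  move=> v; rewrite inE !in_set => /andP[/andP[vs vb] /andP[_ cv]].
  have -> : v = last x1 q1; last exact: mem_last.
  rewrite lq1; apply: (@index_inj V x s) => //; apply/eqP.
  rewrite eqn_leq; apply/andP; split; last exact: cv.
  exact: leq_trans vb bc.
apply: leq_trans (circ cd ud); apply: leq_trans szd.
by rewrite -!addnA leq_add2l leq_addr.
Qed.

End Dirac.

(** * Rotations of a longest path and the resulting cores *)

Section Rotation.
Variables (V : finType) (e : rel V).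
Hypothesis (e_sym : symmetric e) (e_irr : irreflexive e).
Hypothesis cutfree : no_cutvertex e.
Variable t : nat.
Hypothesis t_gt1 : 1 < t.
Hypothesis circ : forall c, cycle e c -> uniq c -> size c <= t.*2.+1.
Hypothesis card_gt : t.*2.+1 < #|V|.
Hypothesis min_deg : forall v, t <= #|nbr e v|.
Hypothesis tight_indep : forall L : {set V}, #|L| <= t ->
  {in L, forall v, #|nbr e v| = t} -> {in L &, forall u v, ~~ e u v}.
Implicit Types (A B Q : {set V}) (p q s : seq V).

Lemma exists_longest : exists x p, longest_path e x p.
Proof.
pose P n := [exists x : V, exists q : n.-tuple V, path e x q && uniq (x :: q)].
have [x0 _] : exists x, x \in [set: V].
  by apply/card_gt0P; rewrite cardsT; apply: leq_ltn_trans card_gt.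
have P0 : exists n, P n.
  by exists 0; apply/existsP; exists x0; apply/existsP; exists [tuple].
have Pmax n : P n -> n <= #|V|.
  case/existsP=> x /existsP[q /andP[_ /card_uniqP uq]].
  by have := max_card [in x :: q]; rewrite uq /= size_tuple; apply: ltnW.
case: (ex_maxnP P0 Pmax) => n /existsP[x /existsP[q /andP[pq uq]]] maxn.
exists x, q; split=> // y r pr ur; rewrite size_tuple; apply: maxn.
by apply/existsP; exists y; apply/existsP; exists (in_tuple r); rewrite pr.
Qed.

Lemma longest_size x p y q : longest_path e x p -> longest_path e y q -> size p = size q.
Proof.
move=> [px ux mx] [py uy my]; apply/eqP; rewrite eqn_leq; apply/andP; split; [exact: (my x p px ux) | exact: (mx y q py uy)].
Qed.

(** An end y of maximal degree: either its degree exceeds t, and then the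
    degree sum forces the other end down to t, or no end has a degree larger
    than t. *)
Lemma exists_end : exists y,
  (exists x p, longest_path e x p /\ last x p = y) /\
  (forall x p, longest_path e x p -> last x p = y -> #|nbr e x| = t).
Proof.
have [x0 [p0 lp0]] := exists_longest.
pose P y := [exists x : V, exists q : (size p0).-tuple V,
  [&& path e x q, uniq (x :: q) & last x q == y]].
have PP y : reflect (exists x p, longest_path e x p /\ last x p = y) (P y).
  apply: (iffP existsP) => [[x /existsP[q /and3P[pq uq /eqP lq]]]|[x [p [lp lpy]]]].
    exists x, q; split=> //; split=> // z r pr ur; rewrite size_tuple.
    by case: lp0 => _ _ m0; apply: (m0 z r).
  have sp : size p == size p0 by rewrite (longest_size lp lp0).
  by have [pp up _] := lp; exists x; apply/existsP; exists (Tuple sp); rewrite pp up lpy /=.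
have P0 : P (last x0 p0) by apply/PP; exists x0, p0.
case: (arg_maxnP (fun y => #|nbr e y|) P0) => y /PP Py maxy.
exists y; split=> // x p lp lpy; apply/eqP; rewrite eqn_leq min_deg andbT.
have [q [lq lqx _ _]] := longest_rev e_sym lp.
have xy : #|nbr e x| <= #|nbr e y| by apply: maxy; apply/PP; exists (last x p), q.
have deg0 v : 0 < #|nbr e v| by apply: leq_trans (min_deg v); apply: ltnW.
have := longest_degree_sum e_sym e_irr cutfree circ card_gt lp deg0.
rewrite lpy; move: xy; clear; lia.
Qed.

Variable y : V.
Hypothesis y_end : exists x p, longest_path e x p /\ last x p = y.
Hypothesis head_deg : forall x p, longest_path e x p -> last x p = y -> #|nbr e x| = t.

(** The path is kept as one sequence, because rotations move the first vertex. *)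
Definition longest_to s := if s is x :: p then longest_path e x p /\ last x p = y else False.

Lemma longest_to_uniq s : longest_to s -> uniq s.
Proof. by case: s => //= x p [[]]. Qed.

Lemma longest_to_deg s : longest_to s -> #|nbr e (head y s)| = t.
Proof. by case: s => //= x p [/head_deg lp] /lp. Qed.

Lemma longest_to_nbr s w : longest_to s -> e (head y s) w -> w \in s.
Proof. by case: s => //= x p [/(longest_nbr e_sym) lp _] /lp. Qed.

Lemma longest_to_size s : longest_to s -> t < size s.
Proof.
move=> ys; have := uniq_leq_size (enum_uniq (head y s |: nbr e (head y s))) (s2 := s).
rewrite -cardE cardsU1 inE e_irr longest_to_deg // add1n; apply=> v.
rewrite mem_enum !inE => /predU1P[->|/longest_to_nbr]; last exact.
by case: s ys => // x p _; apply: mem_head.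
Qed.

(** The rotation of Posa: the edge from the head to w replaces the path edge
    that enters w. *)
Lemma longest_to_rot c1 w c2 :
  longest_to (c1 ++ w :: c2) -> 0 < size c1 -> e (head y c1) w -> longest_to (rev c1 ++ w :: c2).
Proof.
case: c1 => // x p [lp ly] _ /= xw; have [pp up maxp] := lp.
rewrite lastI rev_rcons /=; split; last by rewrite -ly !last_cat.
have E : last x p :: rev (belast x p) ++ w :: c2 = rev (x :: p) ++ w :: c2.
  by rewrite -cat_cons -rev_rcons -lastI.
have pE : perm_eq (rev (x :: p) ++ w :: c2) (x :: p ++ w :: c2).
  by rewrite -cat_cons perm_cat2r perm_rev.
split; last 1 first.
- move=> z r pr ur; apply: leq_trans (maxp z r pr ur) _.
  by rewrite !size_cat size_rev size_belast.
- move: pp; rewrite !cat_path => /andP[pp /= /andP[lw pw]].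
  rewrite rev_path (eq_path (e' := e)) // pp /=.
  have -> : last (last x p) (rev (belast x p)) = x; last by rewrite xw.
  by case: (p) => // a b; rewrite /= rev_cons last_rcons.
- by rewrite E (perm_uniq pE).
Qed.

Lemma longest_to_split s w : longest_to s -> e (head y s) w ->
  exists c1 c2, [/\ s = c1 ++ w :: c2, 0 < size c1 & head y c1 = head y s].
Proof.
move=> ys xw; have ws := longest_to_nbr ys xw.
case/splitPr: s / ws ys xw => c1 c2 ys xw; exists c1, c2; split=> //.
  by case: c1 {ys} xw => //=; rewrite e_irr.
by case: c1 ys xw => //= _; rewrite e_irr.
Qed.

Lemma longest_to_prefix_cycle c1 w c2 : longest_to (c1 ++ w :: c2) -> 0 < size c1 ->
  e (head y c1) w -> size c1 <= t.*2.
Proof.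
case: c1 => // x p [[pp up _] _] _ /= xw.
have {}pp : path e x (p ++ w :: c2) by exact: pp.
have {}up : uniq (x :: p ++ w :: c2) by exact: up.
have [|||||||c [cc uc szc]] := @glue_cycle V e e_sym x (rcons p w) [:: w].
- by move: pp; rewrite -cat_rcons cat_path => /andP[].
- by rewrite /= xw.
- by rewrite last_rcons.
- by move: up; rewrite -cat_rcons -cat_cons cat_uniq => /andP[].
- by rewrite /= inE andbT; apply: contraTneq xw => ->; rewrite e_irr.
- by [].
- by move=> v _; rewrite inE => /eqP.
have := circ cc uc; rewrite szc size_rcons /= addn1 ltnS; exact.
Qed.

(** These are the first vertices of the rotations of s. *)
Definition nbr_preds s := [set v | [exists w, [&& e (head y s) w, w \in s & v == nth y s (index w s).-1]]].

Lemma predsP s v : longest_to s ->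
  reflect (exists c1 w c2, [/\ s = c1 ++ w :: c2, 0 < size c1, head y c1 = head y s,
                             e (head y s) w & v = last y c1])
          (v \in nbr_preds s).
Proof.
move=> ys; rewrite inE.
have idx c1 w c2 : s = c1 ++ w :: c2 -> 0 < size c1 -> nth y s (index w s).-1 = last y c1.
  move=> Es c1_gt0; have := longest_to_uniq ys.
  rewrite {1 2 3}Es cat_uniq => /and3P[_ /norP[wc1 _] _].
  rewrite index_cat (negPf wc1) /= eqxx addn0 nth_cat ltn_predL c1_gt0.
  by rewrite nth_last; case: c1 c1_gt0 {Es wc1} => //.
apply: (iffP existsP) => [[w /and3P[xw ws /eqP->]]|[c1 [w [c2 [Es c1_gt0 hc xw ->]]]]].
  have [c1 [c2 [Es c1_gt0 hc]]] := longest_to_split ys xw.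
  by exists c1, w, c2; split=> //; apply: idx Es c1_gt0.
exists w; rewrite xw (longest_to_nbr ys xw) /=; apply/eqP; exact/esym/idx/c1_gt0/Es.
Qed.

Lemma pivot_uniq (c1 c2 c1' c2' : seq V) a : uniq (c1 ++ a :: c2) ->
  c1 ++ a :: c2 = c1' ++ a :: c2' -> c1 = c1' /\ c2 = c2'.
Proof.
elim: c1 c1' => [|b c1 IHc] [|b' c1'] /=.
- by move=> _ [->].
- by case/andP=> ac2 _ [_ E]; move: ac2; rewrite E mem_cat mem_head orbT.
- by case/andP=> ac _ [E _]; move: ac; rewrite E mem_cat mem_head orbT.
by case/andP=> _ uc [-> /(IHc _ uc)[-> ->]].
Qed.

Lemma preds_rot s v : longest_to s -> v \in nbr_preds s ->
  exists c1 w c2, [/\ s = c1 ++ w :: c2, longest_to (rev c1 ++ w :: c2),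
    head y (rev c1 ++ w :: c2) = v & size c1 <= t.*2].
Proof.
move=> ys /(predsP _ ys)[c1 [w [c2 [Es c1_gt0 hc xw ->]]]].
exists c1, w, c2; rewrite {}Es in ys *; split=> //.
- by apply: longest_to_rot; rewrite // hc.
- by case/lastP: c1 c1_gt0 {ys hc} => // c1 a _; rewrite rev_rcons last_rcons.
- by apply: longest_to_prefix_cycle ys c1_gt0 _; rewrite hc.
Qed.

Lemma card_preds s : longest_to s -> #|nbr_preds s| = t.
Proof.
move=> ys; rewrite -(longest_to_deg ys).
have -> : nbr_preds s = (fun w => nth y s (index w s).-1) @: nbr e (head y s).
  apply/setP=> v; rewrite inE; apply/existsP/imsetP=> [[w /and3P[xw ws /eqP->]]|[w]].
    by exists w; rewrite ?inE.
  by rewrite inE => xw ->; exists w; rewrite xw longest_to_nbr //=.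
apply: card_in_imset => w w'; rewrite !inE => xw xw' /eqP.
have idx z : e (head y s) z -> 0 < index z s < size s.
  move=> xz; rewrite index_mem longest_to_nbr // andbT.
  by case: s ys xz {xw xw'} => //= x p _; case: eqP => // ->; rewrite e_irr.
have [/andP[i0 il] /andP[j0 jl]] := (idx w xw, idx w' xw').
rewrite nth_uniq ?longest_to_uniq ?(leq_ltn_trans (leq_pred _)) // => /eqP E.
apply: (@index_inj V y s); rewrite ?longest_to_nbr //.
by rewrite -(prednK i0) E prednK.
Qed.

(** There are t predecessors, and each is the first vertex of a longest path
    to y, hence has degree t. *)
Lemma preds_indep s : longest_to s -> {in nbr_preds s &, forall u v, ~~ e u v}.
Proof.
move=> ys; apply: tight_indep; first by rewrite card_preds.
by move=> v /(preds_rot ys)[c1 [w [c2 [_ ys' <- _]]]]; apply: longest_to_deg.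
Qed.

Lemma head_preds s : longest_to s -> head y s \in nbr_preds s.
Proof.
move=> ys; have sz := longest_to_size ys; apply/(predsP _ ys).
case: s ys sz => [|x [|z p]] //; first by rewrite ltnNge (ltnW t_gt1).
by case=> -[/andP[xz _] _ _] _ _; exists [:: x], z, p; split.
Qed.

Lemma preds_nbr s v : longest_to s -> v \in nbr_preds s -> ~~ e (head y s) v.
Proof. by move=> ys vL; apply: (preds_indep ys) => //; apply: head_preds. Qed.

Lemma last_preds s c1 w c2 : longest_to s -> s = c1 ++ w :: c2 -> e (head y s) w ->
  last y c1 \in nbr_preds s.
Proof.
move=> ys Es xw; apply/(predsP _ ys); exists c1, w, c2.
by case: c1 Es => [|x c1] Es; split=> //; move: xw; rewrite Es //= e_irr.
Qed.

(** Otherwise the first of the two neighbours would be the predecessor of the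
    second, hence a rotated first vertex like the head itself, and these are
    pairwise nonadjacent. *)
Lemma not_consecutive s c1 a b c2 : longest_to s -> s = c1 ++ a :: b :: c2 ->
  e (head y s) a -> ~~ e (head y s) b.
Proof.
move=> ys Es xa; apply/negP=> xb.
have := @last_preds s (rcons c1 a) b c2 ys; rewrite cat_rcons last_rcons => /(_ Es xb).
by move/(preds_nbr ys); rewrite xa.
Qed.

Lemma take_rev_cat k (c1 c2 : seq V) : size c1 <= k -> take k (rev c1 ++ c2) =i take k (c1 ++ c2).
Proof.
by move=> ck v; rewrite !take_cat size_rev ltnNge ck /= !mem_cat mem_rev.
Qed.

Lemma nbr_take s w : longest_to s -> e (head y s) w -> w \in take t.*2.+1 s.
Proof.
move=> ys xw; have [c1 [c2 [Es c1_gt0 hc]]] := longest_to_split ys xw.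
have : size c1 <= t.*2.
  by rewrite Es in ys; apply: longest_to_prefix_cycle ys c1_gt0 _; rewrite hc.
rewrite -ltnS => c1k; rewrite Es take_cat ltnNge (ltnW c1k) /= mem_cat.
by case: (t.*2.+1 - size c1) (subn_gt0 (size c1) t.*2.+1) => [|k _]; rewrite ?c1k //= mem_head orbT.
Qed.

Lemma preds_take s k v : longest_to s -> {in nbr e (head y s), forall w, w \in take k.+1 s} ->
  v \in nbr_preds s -> v \in take k s.
Proof.
move=> ys nbk /(predsP _ ys)[c1 [w [c2 [Es c1_gt0 hc xw ->]]]].
have := nbk w; rewrite inE xw => /(_ isT).
have us := longest_to_uniq ys; have ws := longest_to_nbr ys xw.
have lc1 : last y c1 \in c1 by case: (c1) c1_gt0 => //= a c _; rewrite mem_last.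
rewrite in_take // Es index_cat; move: us; rewrite {1}Es cat_uniq => /and3P[_ /norP[/negPf-> _] _].
rewrite /= eqxx addn0 ltnS => ck.
by rewrite take_cat ltnNge ck /= mem_cat lc1.
Qed.

(** The neighbours of the head and their predecessors are disjoint sets of t
    vertices each, so they fill the first 2t positions.  A rotation does not
    change the set of the first 2t vertices, so the neighbours of every
    predecessor are confined to these positions too, and avoid the
    predecessors. *)
Lemma bipartite_core :
    (forall s w, longest_to s -> e (head y s) w -> w \in take t.*2 s) ->
  exists L A : {set V}, [/\ #|L| = t, #|A| = t & {in L, forall u, nbr e u = A}].
Proof.
move=> H; have [x [p lp]] := y_end; set s := x :: p; have ys : longest_to s := lp.
exists (nbr_preds s), (nbr e (head y s)); split; rewrite ?card_preds ?longest_to_deg //.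
set L := nbr_preds s; set A := nbr e (head y s); pose Q := [set v in take t.*2 s].
have cL : #|L| = t := card_preds ys; have cA : #|A| = t := longest_to_deg ys.
have disLA : [disjoint L & A].
  by apply/pred0Pn=> -[v /andP[/(preds_nbr ys)/negPf vL]]; rewrite /= inE vL.
have cQ : #|Q| <= t.*2.
  rewrite cardsE; apply: leq_trans (card_size _) _.
  by rewrite size_take; case: ltnP.
have AQ : A \subset Q by apply/subsetP=> w; rewrite !inE => /(H s w ys).
have LQ : L \subset Q.
  apply/subsetP=> v vL; rewrite inE; have: v \in take t.*2.-1 s.
    apply: preds_take => // w; rewrite inE prednK ?double_gt0 ?(ltnW t_gt1) //; exact: H.
  rewrite -{2}(@prednK t.*2) ?double_gt0 ?(ltnW t_gt1) //.
  set k := t.*2.-1; case: (ltnP k (size s)) => ks; last by rewrite !take_oversize // ltnW.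
  by rewrite (take_nth y) // mem_rcons inE orbC => ->.
have QE : Q = L :|: A.
  apply/esym/eqP; rewrite eqEcard subUset LQ AQ cardsU.
  rewrite (disjoint_setI0 disLA) cards0 subn0 cL cA addnn; exact: cQ.
move=> u uL; have [c1 [w [c2 [Es ys' hu c1t]]]] := preds_rot ys uL.
apply/eqP; rewrite eqEcard cA -hu longest_to_deg // leqnn andbT hu.
apply/subsetP=> v uv.
have: v \in Q.
  rewrite in_set Es -take_rev_cat //; apply: H => //; rewrite hu; move: uv; rewrite inE; exact.
rewrite QE inE => /orP[vL|//]; rewrite inE in uv.
by case/negP: (preds_indep ys uL vL).
Qed.

(** In this core the vertices of L fail to have a common neighbourhood only
    because each of them sees just one of the adjacent vertices a and b. *)
Definition split_core (L A0 : {set V}) a b :=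
  [/\ #|L| = t, #|A0| = t.-1, e a b, [&& a \notin A0, b \notin A0 & [disjoint L & b |: (a |: A0)]] &
    [/\ {in L, forall u, nbr e u = a |: A0 \/ nbr e u = b |: A0},
        exists2 u, u \in L & nbr e u = a |: A0 &
        exists2 u, u \in L & nbr e u = b |: A0]].

(** Now the first 2t + 1 positions contain the t predecessors L, the t
    neighbours of the head and exactly one more vertex b.  The vertex a before
    b is a neighbour of the head, the vertex after b belongs to L.  The
    neighbours of a vertex u of L lie among the t + 1 vertices outside L, and
    a and b, consecutive also on the path rotated to u, are not both among
    them. *)
Lemma split_core_of_long s w : longest_to s -> e (head y s) w -> w \notin take t.*2 s ->
  exists L A0 a b, split_core L A0 a b.
Proof.
move=> ys xw wQ.
set L := nbr_preds s; set A := nbr e (head y s); pose Q := [set v in take t.*2.+1 s].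
have cL : #|L| = t := card_preds ys; have cA : #|A| = t := longest_to_deg ys.
have us := longest_to_uniq ys; have ws := longest_to_nbr ys xw.
have wQ1 := nbr_take ys xw.
have wi : index w s = t.*2.
  apply/eqP; rewrite eqn_leq; move: wQ wQ1; rewrite !in_take // -leqNgt ltnS => ->.
  by move=> ->.
have [c1 [c2 [Es c1_gt0 hc]]] := longest_to_split ys xw.
have sc1 : size c1 = t.*2.
  move: us; rewrite Es cat_uniq => /and3P[_ /norP[/negPf nw _] _].
  by rewrite -wi Es index_cat nw /= eqxx addn0.
have QE : Q = [set v in rcons c1 w].
  apply/setP=> v; rewrite !in_set Es -cat_rcons take_cat size_rcons sc1 ltnn subnn.
  by rewrite take0 cats0.
have cQ : #|Q| = t.*2.+1.
  rewrite QE cardsE (card_uniqP _) ?size_rcons ?sc1 //.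
  by move: us; rewrite Es -cat_rcons cat_uniq => /andP[].
have nbQ u s' : longest_to s' -> head y s' = u -> (forall v, v \in take t.*2.+1 s' -> v \in Q) -> nbr e u \subset Q.
  move=> ys' hu Qs'; apply/subsetP=> v; rewrite inE -hu => /(nbr_take ys')/Qs'; exact.
have AQ : A \subset Q by apply: (nbQ _ s) => // v; rewrite inE.
have LQ : L \subset Q.
  apply/subsetP=> v vL; rewrite in_set.
  have: v \in take t.*2 s by apply: preds_take => // z; rewrite inE; apply: nbr_take.
  rewrite Es -cat_rcons !take_cat size_rcons sc1 ltnSn ltnn subnn take0 cats0.
  by move/mem_take.
have nAL v : v \in L -> v \notin A by move=> /(preds_nbr ys); rewrite inE.
have cA' : #|Q :\: L| = t.+1.
  rewrite cardsD (setIidPr LQ) cQ cL -addnn; clear; lia.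
have AA' : A \subset Q :\: L.
  apply/subsetP=> v vA; rewrite inE (subsetP AQ) // andbT.
  by apply: contraL vA => /nAL.
have [b bA'] : exists b, b \in (Q :\: L) :\: A.
  by apply/card_gt0P; rewrite cardsD (setIidPr AA') cA' cA subSnn.
have [bA bL bQ] : [/\ b \notin A, b \notin L & b \in Q].
  by move: bA'; rewrite in_setD in_setD => /and3P[].
have A'E : Q :\: L = b |: A.
  apply/esym/eqP; rewrite eqEcard subUset sub1set AA' andbT cA' cardsU1 bA cA leqnn andbT.
  by rewrite in_setD bL.
have bw : b != w by apply: contraNneq bA => ->; rewrite inE.
have bc1 : b \in c1.
  by move: bQ; rewrite QE in_set mem_rcons inE (negPf bw).
case/splitPr: c1 / bc1 Es QE {sc1 hc c1_gt0} => d1 d2 Es QE.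
have bh : b != head y s by apply: contraNneq bL => ->; apply: head_preds.
case/lastP: d1 => [|d1 a] in Es QE *; first by rewrite Es /= eqxx in bh.
have [b' [d3 [Ed b'Q]]] : exists b' d3, d2 ++ w :: c2 = b' :: d3 /\ b' \in Q.
  case: d2 Es QE => [|b' d2] Es QE; first by exists w, c2; rewrite in_set.
  exists b', (d2 ++ w :: c2); rewrite QE in_set mem_rcons !inE mem_cat !inE eqxx !orbT.
  by split.
have {}Es : s = d1 ++ a :: b :: b' :: d3 by rewrite Es -Ed -!catA cat_rcons.
have aQ : a \in Q by rewrite QE in_set mem_rcons inE mem_cat mem_rcons mem_head !orbT.
have ab : e a b.
  have: sorted e s by case: (s) ys => // x p [[]].
  by rewrite Es sorted_cat_cons => /andP[_] /= /andP[].
have bb' : e b b'.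
  have: sorted e s by case: (s) ys => // x p [[]].
  by rewrite Es sorted_cat_cons => /andP[_] /= /and3P[].
have b'L : b' \in L.
  have b'A : b' \notin A.
    apply: contra bL; rewrite inE => xb'.
    have := @last_preds s (rcons (rcons d1 a) b) b' d3 ys.
    by rewrite !cat_rcons last_rcons; apply.
  have nbb' : b' != b by apply: contraTneq bb' => ->; rewrite e_irr.
  have: b' \notin b |: A by rewrite !inE negb_or nbb' /=; rewrite inE in b'A.
  by rewrite -A'E in_setD b'Q andbT negbK.
have nab : a != b by apply: contraTneq ab => ->; rewrite e_irr.
have aA : a \in A.
  have: a \notin L.
    apply/negP=> /(predsP _ ys)[e1 [w' [e2 [Es' e1_gt0 _ xw' la]]]].
    case/lastP: e1 e1_gt0 Es' la => // e1 a' _; rewrite last_rcons cat_rcons => Es' aa'.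
    rewrite -aa' in Es'; move: us; rewrite Es => us'.
    have [_ [bw' _]] := pivot_uniq us' (etrans (esym Es) Es').
    by move: bA; rewrite inE bw' xw'.
  move=> aL; have: a \in b |: A by rewrite -A'E in_setD aL.
  by rewrite in_setU1 (negPf nab).
pose A0 := A :\ a.
have A'E2 : Q :\: L = b |: (a |: A0) by rewrite A'E setD1K.
have bA0 : b \notin A0 by rewrite inE negb_and bA orbT.
have cA0 : #|A0| = t.-1 by rewrite -cA (cardsD1 a A) aA.
(* On the path rotated at w', the vertices a and b are still consecutive: w' is
   not b, so they are reversed together or not at all. *)
have not_both u : u \in L -> e u a -> ~~ e u b.
  move/(predsP _ ys)=> [e1 [w' [e2 [Es' e1_gt0 hc xw' lu]]]].
  have ys' : longest_to (rev e1 ++ w' :: e2).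
    by apply: longest_to_rot; rewrite ?hc -?Es'.
  have hu : head y (rev e1 ++ w' :: e2) = u.
    by rewrite lu; case/lastP: (e1) e1_gt0 => // e3 z _; rewrite rev_rcons last_rcons.
  have w's := longest_to_nbr ys xw'.
  have w'b : w' != b by apply: contraNneq bA => <-; rewrite inE.
  have piv f1 f2 : s = f1 ++ w' :: f2 -> e1 = f1 /\ e2 = f2.
    move=> Ef; rewrite Es' in us; apply: (pivot_uniq us); congruence.
  rewrite -hu; move: w's.
  rewrite {1}Es mem_cat (in_cons a) (in_cons b) (negPf w'b) /= => /or3P[w'd|/eqP E|w'd].
  - case/splitPr: d1 / w'd Es {QE} => f1 f2 Es.
    have [E1 E2] := piv f1 (f2 ++ [:: a, b, b' & d3]) (etrans Es (esym (catA _ _ _))).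
    apply: (@not_consecutive _ (rev e1 ++ w' :: f2) _ _ (b' :: d3) ys').
    by rewrite E2 -catA.
  - rewrite -E in Es *; have [E1 E2] := piv d1 [:: b, b' & d3] Es.
    by apply: (@not_consecutive _ (rev e1) _ _ (b' :: d3) ys'); rewrite E2.
  - move: Es; case/splitPr: (b' :: d3) / w'd => f1 f2 Es.
    have [E1 E2] := piv (d1 ++ [:: a, b & f1]) f2 (etrans Es (catA _ [:: a, b & f1] _)).
    apply: contraL; apply: (@not_consecutive _ (rev f1) _ _ (rev d1 ++ w' :: f2) ys').
    by rewrite E1 E2 rev_cat !rev_cons !cat_rcons -!catA.
have nbA' u : u \in L -> nbr e u \subset b |: (a |: A0).
  move=> uL; have [e1 [w' [e2 [Es' ys' hu e1t]]]] := preds_rot ys uL.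
  rewrite -A'E2; apply/subsetP=> v uv; rewrite in_setD; apply/andP; split.
    by apply/negP=> vL; move: uv; rewrite inE (negPf (preds_indep ys uL vL)).
  move: v uv; apply/subsetP; apply: nbQ ys' hu _ => v.
  by rewrite take_rev_cat ?in_set ?Es' // leqW.
have degL u : u \in L -> #|nbr e u| = t.
  by move=> /(preds_rot ys)[e1 [w' [e2 [_ ys' <- _]]]]; apply: longest_to_deg.
have caA0 : #|a |: A0| = t by rewrite setD1K.
have cbA0 : #|b |: A0| = t by rewrite cardsU1 bA0 cA0 add1n prednK // ltnW.
have two u : u \in L -> nbr e u = a |: A0 \/ nbr e u = b |: A0.
  move=> uL; have /subsetP nbu := nbA' u uL.
  have [ua|nua] := boolP (e u a); [left|right]; apply/eqP; rewrite eqEcard degL // ?caA0 ?cbA0 leqnn andbT.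
    apply/subsetP=> v uv; have := nbu v uv; rewrite in_setU1 => /predU1P[vb|//].
    by move: uv; rewrite vb inE (negPf (not_both u uL ua)).
  apply/subsetP=> v uv; have := nbu v uv; rewrite !in_setU1 => /or3P[->//|/eqP va|->]; last by rewrite orbT.
  by move: uv; rewrite va inE (negPf nua).
exists L, A0, a, b; split=> //.
  rewrite bA0 in_setD1 eqxx /= -A'E2 disjoint_sym.
  by apply/pred0Pn=> -[v /andP[/setDP[_ /negPf vL]]] /=; rewrite vL.
split=> //.
  by exists (head y s); [apply: head_preds | rewrite setD1K].
exists b' => //; have [Eb|//] := two b' b'L.
have: b \in nbr e b' by rewrite inE e_sym.
by rewrite Eb in_setU1 eq_sym (negPf nab) (negPf bA0).
Qed.

End Rotation.

(** * Cycles through a core and the rest of the graph *)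

Section Alternate.

(** The vertices of a path that zigzags between the two sides of a complete
    bipartite graph, without its initial vertex; surplus entries of the first
    list are dropped. *)
Fixpoint alternate (T : Type) (ls bs : seq T) :=
  if (ls, bs) is (l :: ls', b :: bs') then l :: b :: alternate ls' bs' else [::].

Lemma size_alternate (T : Type) (ls bs : seq T) :
  size bs <= size ls -> size (alternate ls bs) = (size bs).*2.
Proof.
by elim: ls bs => [|l ls IHls] [|b bs] //= sz; rewrite IHls // doubleS.
Qed.

Lemma last_alternate (T : Type) x (ls bs : seq T) :
  size bs <= size ls -> last x (alternate ls bs) = last x bs.
Proof. by elim: ls bs x => [|l ls IHls] [|b bs] x //= sz; apply: IHls. Qed.

Lemma mem_alternate (T : eqType) (ls bs : seq T) : {subset alternate ls bs <= ls ++ bs}.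
Proof.
elim: ls bs => [|l ls IHls] [|b bs] //= v; rewrite !inE mem_cat inE.
case/or3P=> [->//|->|/IHls]; first by rewrite !orbT.
by rewrite mem_cat => /orP[]->; rewrite !orbT.
Qed.

Lemma uniq_alternate (T : eqType) (ls bs : seq T) :
  uniq (ls ++ bs) -> uniq (alternate ls bs).
Proof.
elim: ls bs => [|l ls IHls] [|b bs] //; rewrite cat_cons !cons_uniq.
rewrite -[b :: bs]/([:: b] ++ bs) => /andP[lN]; rewrite uniq_catCA cat1s cons_uniq.
case/andP=> bN u; rewrite /= inE negb_or IHls // andbT -andbA; apply/and3P; split.
- by apply: contraNneq lN => ->; rewrite mem_cat !inE eqxx orbT.
- by apply: contra lN => /mem_alternate; rewrite !mem_cat => /orP[]->; rewrite ?orbT.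
- by apply: contra bN => /mem_alternate.
Qed.

Lemma path_alternate (T : eqType) (e : rel T) x (ls bs : seq T) :
    symmetric e -> {in ls & bs, forall l b, e l b} ->
    (if ls is l :: _ then e x l else true) ->
  path e x (alternate ls bs).
Proof.
move=> e_sym; elim: ls bs x => [|l ls IHls] [|b bs] //= x lb xl.
rewrite xl lb ?mem_head //=; apply: IHls => [l' b' l's b's|].
  by apply: lb; rewrite inE ?l's ?b's orbT.
case: ls lb => // l' ls lb; rewrite e_sym; apply: lb; last exact: mem_head.
by rewrite !inE eqxx orbT.
Qed.

End Alternate.

Arguments alternate : simpl never.

Section Cores.
Variables (V : finType) (e : rel V).
Hypothesis (e_sym : symmetric e) (e_irr : irreflexive e).
Hypothesis cutfree : no_cutvertex e.
Variable t : nat.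
Hypothesis t_gt1 : 1 < t.
Hypothesis circ : forall c, cycle e c -> uniq c -> size c <= t.*2.+1.
Implicit Types (A B Q L S : {set V}) (p q s : seq V).

(** Vertices of S have all their neighbours in B, so a path that first meets B
    at its end cannot end in S. *)
Lemma ab_path_last A B S x q : ab_path e A B x q -> x \notin B ->
    {in S, forall v, nbr e v \subset B} ->
  last x q \notin S /\ 0 < size q.
Proof.
case=> _ [pq uq _ [lB onlyB]] xB nbS.
case/lastP: q pq uq lB onlyB => [|q z] pq uq lB onlyB; first by rewrite lB in xB.
rewrite last_rcons in onlyB *; rewrite size_rcons; split=> //; apply/negP=> zS.
move: pq; rewrite rcons_path => /andP[_ ez].
have lz : last x q = z.
  apply: (onlyB (last x q)); first by rewrite -rcons_cons mem_rcons in_cons mem_last orbT.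
  by apply: (subsetP (nbS z zS)); rewrite inE e_sym.
by rewrite lz e_irr in ez.
Qed.

(** Two disjoint paths lead from the ends of an edge outside Q to Q, and end
    in A.  A connection of the two ends inside Q closes a cycle; it has only k
    + 3 vertices if both paths are single edges. *)
Lemma outer_edge_cycle Q (S A : {set V}) k w w' :
    Q = S :|: A -> {in S, forall v, nbr e v \subset Q} ->
    {in A &, forall x y, x != y -> conn e Q x y k} ->
    w \notin Q -> w' \notin Q -> e w w' -> 1 < #|Q| ->
  exists a b c, [/\ cycle e c, uniq c, k + 3 <= size c,
     [/\ a \in A, b \in A & a != b] &
     size c <= k + 3 -> e w a /\ e w' b].
Proof.
move=> QE nbS connA wQ w'Q ww' Q_gt1.
have nww' : w != w' by apply: contraTneq ww' => ->; rewrite e_irr.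
have sep v : exists x q, ab_path e [set w; w'] Q x q /\ v \notin x :: q.
  apply: ab_path_avoid => //.
    have [wv|wv] := eqVneq w v; [exists w' | exists w] => //; rewrite ?inE ?eqxx ?orbT //.
    by rewrite -wv eq_sym.
  have [a aQ] : exists a, a \in Q :\ v.
    by apply/card_gt0P; move: Q_gt1; rewrite (cardsD1 v Q); case: (v \in Q) => // /ltnW.
  by exists a; move: aQ; rewrite in_setD1 => /andP[].
have [x0 [q0 [P0 _]]] := sep w.
have [x1 [q1 [y1 [r1 [X Y dis _ _]]]]] := two_disjoint_paths sep P0.
have xy : x1 != y1.
  by apply/eqP=> E; have := dis x1 (mem_head _ _); rewrite E mem_head.
wlog x1w : x1 q1 y1 r1 X Y dis xy / x1 = w.
  have [x1A _] := X; have [y1A _] := Y => H.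
  move: x1A; rewrite !inE => /orP[] /eqP x1E; first exact: (H x1 q1 y1 r1).
  apply: (H y1 r1 x1 q1) => //; first exact: disj_pathsC.
    by rewrite eq_sym.
  by move: y1A; rewrite !inE => /orP[] /eqP // y1E; rewrite x1E y1E eqxx in xy.
have y1w : y1 = w'.
  by have [y1A _] := Y; move: y1A; rewrite !inE => /orP[] /eqP // y1E; rewrite x1w y1E eqxx in xy.
subst x1 y1.
have [nlx q1_gt0] := ab_path_last X wQ nbS.
have [nly r1_gt0] := ab_path_last Y w'Q nbS.
have [_ [pq1 _ _ [lxQ _]]] := X; have [_ [pr1 _ _ [lyQ _]]] := Y.
have laA : last w q1 \in A by move: lxQ; rewrite QE inE (negPf nlx).
have lbA : last w' r1 \in A by move: lyQ; rewrite QE inE (negPf nly).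
have nl : last w q1 != last w' r1.
  by apply/eqP=> E; have := dis _ (mem_last w q1); rewrite E mem_last.
have C1 : conn e [set w; w'] w w' 1.
  exists [:: w']; rewrite /= ww' !inE nww'; split=> // v.
  by rewrite !inE.
have [|c [cc uc szc]] := link_cycle e_sym X Y dis C1 (connA _ _ laA lbA nl).
  move=> v; rewrite inE => /andP[]; rewrite !inE => /orP[] /eqP->; first by rewrite (negPf wQ).
  by rewrite (negPf w'Q).
exists (last w q1), (last w' r1), c; split=> //.
  by move: szc q1_gt0 r1_gt0; clear; lia.
move=> szc'; have [sq sr] : size q1 = 1 /\ size r1 = 1.
  by move: szc szc' q1_gt0 r1_gt0; clear; lia.
move: pq1 pr1; case: (q1) sq => [|a1 [|? ?]] // _; case: (r1) sr => [|b1 [|? ?]] // _.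
by move=> /= /andP[-> _] /andP[-> _].
Qed.


Lemma conn_intro Q x z b k : path e x z -> uniq (x :: z) -> last x z = b ->
  {subset x :: z <= Q} -> size z = k -> conn e Q x b k.
Proof. by move=> pz uz lz sz <-; exists z. Qed.

Section SplitCore.
Variables (L A0 : {set V}) (a b : V).
Hypothesis core : split_core e t L A0 a b.

Lemma split_core_sym : split_core e t L A0 b a.
Proof.
have [cL cA0 ab /and3P[aA bA dis] [two exa exb]] := core.
split=> //; first by rewrite e_sym.
  by rewrite aA bA /=; move: dis; rewrite setUCA.
by split=> // u /two[]; [right | left].
Qed.

(** L is listed with a vertex u adjacent to a first and a vertex w adjacent to
    b second: paths through the core pass through u to reach a and through w
    to reach b. *)
Lemma split_core_lists : exists u w ls,
  [/\ nbr e u = a |: A0, nbr e w = b |: A0, size ls = t.-2,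
      uniq [:: u, w & ls] & [:: u, w & ls] =i L].
Proof.
have [cL cA0 ab /and3P[aA bA dis] [two [u uL nu] [w wL nw]]] := core.
have nuw : w != u.
  apply: contraNneq aA => E; have: a \in nbr e u by rewrite nu setU11.
  rewrite -E nw in_setU1 => /predU1P[E'|//]; by rewrite E' e_irr in ab.
exists u, w, (enum (L :\ u :\ w)); split=> //.
- rewrite -cardE; have := cardsD1 u L; have := cardsD1 w (L :\ u).
  by rewrite uL in_setD1 wL nuw cL; case: t => [|[|n]] // -> [].
- by rewrite !cons_uniq enum_uniq in_cons !mem_enum !inE !eqxx eq_sym (negPf nuw).
move=> v; rewrite !inE mem_enum !inE.
by have [->|_] := eqVneq v u; rewrite ?uL //; have [->|_] := eqVneq v w; rewrite ?wL.
Qed.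

Let Q := L :|: (b |: (a |: A0)).

Lemma split_core_memL v : v \in L -> v \notin b |: (a |: A0).
Proof.
by have [_ _ _ /and3P[_ _ dis] _] := core => vL; apply: contraTN dis => ?; apply/pred0Pn; exists v; rewrite /= vL.
Qed.

Lemma split_core_alternate l bs :
    uniq l -> {subset l <= L} -> uniq bs -> {subset bs <= A0} ->
  [/\ uniq (alternate l bs), {subset alternate l bs <= Q},
      forall v, v \notin l -> v \notin bs -> v \notin alternate l bs &
      forall x, (if l is l0 :: _ then e x l0 else true) -> path e x (alternate l bs)].
Proof.
have [cL cA0 ab /and3P[aA bA dis] [two _ _]] := core => ul lL ub bA0; split.
- apply: uniq_alternate; rewrite cat_uniq ul ub andbT; apply/hasPn=> v /bA0 vA.
  by apply: contraL vA => /lL/split_core_memL; rewrite !inE; apply: contra => ->; rewrite !orbT.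
- move=> v /mem_alternate; rewrite mem_cat !inE => /orP[/lL->//|/bA0->].
  by rewrite !orbT.
- move=> v vl vb; apply/negP=> /mem_alternate; rewrite mem_cat (negPf vl) (negPf vb) //.
move=> x xl; apply: path_alternate => // v w /lL/two[E|E] /bA0 wA.
  by have: w \in nbr e v; [rewrite E !inE wA orbT | rewrite inE].
by have: w \in nbr e v; [rewrite E !inE wA orbT | rewrite inE].
Qed.

Lemma split_core_ab : conn e Q a b t.*2.
Proof.
have [cL cA0 ab /and3P[aA bA dis] _] := core.
have [u [w [ls [nu nw sls uls lsL]]]] := split_core_lists.
have nab : a != b by apply: contraTneq ab => ->; rewrite e_irr.
have LQ v : v \in L -> v \in Q by rewrite inE => ->.
have [aQ bQ] : a \in Q /\ b \in Q by rewrite !inE !eqxx !orbT.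
have uL : u \in L by rewrite -lsL !inE eqxx.
have wL : w \in L by rewrite -lsL !inE eqxx orbT.
have ulL : {subset u :: ls <= L} by move=> v; rewrite -lsL !inE => /orP[]->; rewrite ?orbT.
have /andP[wul uul] : (w \notin u :: ls) && uniq (u :: ls).
  move: uls; rewrite !cons_uniq !inE !negb_or eq_sym => /and3P[/andP[-> ->] -> ->] //.
have subA : {subset enum A0 <= A0} by move=> v; rewrite mem_enum.
have [ualt altQ notin palt] := split_core_alternate uul ulL (enum_uniq A0) subA.
have aL : a \notin L by apply/negP=> /split_core_memL; rewrite !inE eqxx orbT.
have bL : b \notin L by apply/negP=> /split_core_memL; rewrite !inE eqxx.
have wA : w \notin A0 by have := split_core_memL wL; rewrite !inE !negb_or => /and3P[].
have szb : size (enum A0) <= size (u :: ls) by rewrite -cardE cA0 /= sls; case: t t_gt1 => [|[]].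
have lA : last a (enum A0) \in A0.
  rewrite -(mem_enum A0); move: (cA0); rewrite cardE.
  by case: (enum A0) => [|c cs _]; [case: t t_gt1 => [|[]] | rewrite /= mem_last].
(* From a to u, alternately through A0 and L, and finally through w to b. *)
apply: (@conn_intro _ _ (alternate (u :: ls) (enum A0) ++ [:: w; b])).
- rewrite cat_path last_alternate // palt; last first.
    by have: a \in nbr e u; [rewrite nu setU11 | rewrite inE e_sym].
  apply/and3P; split=> //.
    have: last a (enum A0) \in nbr e w by rewrite nw in_setU1 lA orbT.
    by rewrite inE e_sym.
  by rewrite andbT; have: b \in nbr e w; [rewrite nw setU11 | rewrite inE].
- rewrite cons_uniq mem_cat negb_or cat_uniq ualt notin ?mem_enum //=; last by apply: contra aL => /ulL.
  rewrite !inE !orbF negb_or nab andbT [w == b](contraNF _ bL) ?andbT /=; last by move/eqP <-.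
  rewrite (contraNneq _ aL) ?andTb => [|-> //]; rewrite negb_or !notin ?mem_enum //.
  by apply: contra bL => /ulL.
- by rewrite last_cat.
- move=> v; rewrite in_cons mem_cat in_cons mem_seq1.
  by case/or4P=> [/eqP->|/altQ|/eqP->|/eqP->] //; apply: LQ.
- rewrite size_cat size_alternate // -cardE cA0 /=; move: t_gt1; clear; lia.
Qed.

Lemma split_core_aA y : y \in A0 -> conn e Q a y t.*2.-1.
Proof.
have [cL cA0 ab /and3P[aA bA dis] _] := core => yA.
have [u [w [ls [nu nw sls uls lsL]]]] := split_core_lists.
have nab : a != b by apply: contraTneq ab => ->; rewrite e_irr.
have [aQ bQ] : a \in Q /\ b \in Q by rewrite !inE !eqxx !orbT.
have wlL : {subset w :: ls <= L} by move=> v; rewrite -lsL !inE => /orP[]->; rewrite ?orbT.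
have uwl : uniq (w :: ls) by move: uls; rewrite cons_uniq => /andP[].
pose bs := rcons (enum (A0 :\ y)) y.
have ubs : uniq bs by rewrite rcons_uniq enum_uniq mem_enum in_setD1 eqxx.
have subA : {subset bs <= A0}.
  by move=> v; rewrite mem_rcons in_cons mem_enum in_setD1 => /predU1P[->|/andP[]].
have sbs : size bs = t.-1 by rewrite size_rcons -cardE -cA0 [RHS](cardsD1 y) yA.
have [ualt altQ notin palt] := split_core_alternate uwl wlL ubs subA.
have aL : a \notin L by apply/negP=> /split_core_memL; rewrite !inE eqxx orbT.
have bL : b \notin L by apply/negP=> /split_core_memL; rewrite !inE eqxx.
have szb : size bs <= size (w :: ls) by rewrite sbs /= sls; case: t t_gt1 => [|[]].
have outN v : v \notin L -> v \notin A0 -> v \notin alternate (w :: ls) bs.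
  by move=> vL vA; apply: notin; [apply: contra vL => /wlL | apply: contra vA => /subA].
(* From a to b, then alternately through L and A0, ending in y. *)
apply: (@conn_intro _ _ (b :: alternate (w :: ls) bs)).
- apply/andP; split=> //; apply: palt.
  by have: b \in nbr e w; [rewrite nw setU11 | rewrite inE e_sym].
- by rewrite !cons_uniq in_cons negb_or nab ualt !outN.
- by rewrite -[last _ _]/(last b (alternate _ _)) last_alternate // last_rcons.
- by move=> v; rewrite !in_cons; case/or3P=> [/eqP->|/eqP->|/altQ].
- rewrite -[size _]/(size (alternate (w :: ls) bs)).+1 size_alternate // sbs; move: t_gt1; clear; lia.
Qed.

Lemma split_core_AA x y : x \in A0 -> y \in A0 -> x != y -> conn e Q x y t.*2.-1.
Proof.
have [cL cA0 ab /and3P[aA bA dis] _] := core => xA yA nxy.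
have [u [w [ls [nu nw sls uls lsL]]]] := split_core_lists.
have nab : a != b by apply: contraTneq ab => ->; rewrite e_irr.
have AQ v : v \in A0 -> v \in Q by rewrite !inE => ->; rewrite !orbT.
have LQ v : v \in L -> v \in Q by rewrite inE => ->.
have [aQ bQ] : a \in Q /\ b \in Q by rewrite !inE !eqxx !orbT.
have uL : u \in L by rewrite -lsL !inE eqxx.
have wlL : {subset w :: ls <= L} by move=> v; rewrite -lsL !inE => /orP[]->; rewrite ?orbT.
have /andP[uwls uwl] : (u \notin w :: ls) && uniq (w :: ls) by move: uls; rewrite cons_uniq.
pose bs := rcons (enum (A0 :\ x :\ y)) y.
have ubs : uniq bs by rewrite rcons_uniq enum_uniq mem_enum in_setD1 eqxx.
have subA : {subset bs <= A0}.
  by move=> v; rewrite mem_rcons in_cons mem_enum !in_setD1 => /predU1P[->|/and3P[]].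
have sbs : (size bs).+1 = t.-1.
  by rewrite size_rcons -cardE -cA0 [RHS](cardsD1 x) (cardsD1 y (A0 :\ x)) in_setD1 xA yA eq_sym nxy.
have [ualt altQ notin palt] := split_core_alternate uwl wlL ubs subA.
have aL : a \notin L by apply/negP=> /split_core_memL; rewrite !inE eqxx orbT.
have bL : b \notin L by apply/negP=> /split_core_memL; rewrite !inE eqxx.
have LA v : v \in L -> v \notin A0.
  by move=> /split_core_memL; rewrite !inE !negb_or => /and3P[].
have szb : size bs <= size (w :: ls) by rewrite /= sls; move: sbs; clear; lia.
have outN v : v \notin w :: ls -> v \notin bs -> v \notin alternate (w :: ls) bs by apply: notin.
have nLw v : v \notin L -> v \notin w :: ls by apply: contra => /wlL.
have nAb v : v \notin A0 -> v \notin bs by apply: contra => /subA.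
have xbs : x \notin bs.
  by rewrite mem_rcons in_cons mem_enum !in_setD1 negb_or nxy eqxx andbF.
have xu : x != u by apply: contraTneq xA => ->; apply: LA.
have xa : x != a by apply: contraTneq xA => ->.
have xb : x != b by apply: contraTneq xA => ->.
have ua : u != a by apply: contraTneq uL => ->.
have ub : u != b by apply: contraTneq uL => ->.
have xL : x \notin L by apply: contraTN xA => /LA.
(* From x through u to a and b, then alternately through L and A0 minus x,
   ending in y. *)
apply: (@conn_intro _ _ [:: u, a, b & alternate (w :: ls) bs]).
- apply/and4P; split=> //; last apply: palt.
  + by have: x \in nbr e u; [rewrite nu in_setU1 xA orbT | rewrite inE e_sym].
  + by have: a \in nbr e u; [rewrite nu setU11 | rewrite inE].
  + by have: b \in nbr e w; [rewrite nw setU11 | rewrite inE e_sym].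
- rewrite !cons_uniq !in_cons !negb_or xu xa xb ua ub nab ualt !outN //; try exact: nLw; try exact: nAb.
  by apply: nAb; apply: LA.
- by rewrite -[last _ _]/(last b (alternate _ _)) last_alternate // last_rcons.
- move=> v; rewrite !in_cons; case/or4P=> [/eqP->|/eqP->|/eqP->|/orP[/eqP->|/altQ]] //.
    exact: AQ.
  exact: LQ.
- rewrite -[size _]/(size (alternate (w :: ls) bs)).+3 size_alternate //; move: sbs; clear; lia.
Qed.

End SplitCore.

(** The path alternates between L and B and, unless a and b are its ends,
    makes use of the edge between them. *)
Lemma split_core_conn L A0 a b x y (B := b |: (a |: A0)) :
    split_core e t L A0 a b -> x \in B -> y \in B -> x != y ->
  conn e (L :|: B) x y t.*2.-1.
Proof.
move=> core; rewrite {}/B.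
have core' := split_core_sym core.
have SE : L :|: (a |: (b |: A0)) = L :|: (b |: (a |: A0)) by congr (_ :|: _); apply: setUCA.
have ab : conn e (L :|: (b |: (a |: A0))) a b t.*2.-1.
  have [z [pz uz lz sz kz]] := split_core_ab core.
  by exists z; split=> //; apply: leq_trans (leq_pred _) kz.
have aA v : v \in A0 -> conn e (L :|: (b |: (a |: A0))) a v t.*2.-1 by apply: split_core_aA.
have bA v : v \in A0 -> conn e (L :|: (b |: (a |: A0))) b v t.*2.-1.
  by rewrite -SE; apply: split_core_aA.
rewrite !in_setU1 => /or3P[/eqP->|/eqP->|xA] /or3P[/eqP->|/eqP->|yA] nxy.
- by case/eqP: nxy.
- exact: conn_sym.
- exact: bA.
- exact: ab.
- by case/eqP: nxy.
- exact: aA.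
- by apply: conn_sym => //; apply: bA.
- by apply: conn_sym => //; apply: aA.
- exact: split_core_AA.
Qed.

(** An edge outside the core would be prolonged by a path with 2t vertices
    through the core, which makes the cycle too long.  So would a vertex
    adjacent to both a and b, because a and b are the ends of a path through
    the whole core. *)
Lemma split_core_structure L A0 a b (B := b |: (a |: A0)) :
    split_core e t L A0 a b ->
  [/\ #|B| = t.+1, {in ~: B, forall v, nbr e v \subset B /\ #|nbr e v| <= t}
    & exists2 l, l \notin B & B :\ b \subset nbr e l].
Proof.
move=> core; have [cL cA0 ab /and3P[aA bA dis] [two [u uL nu] _]] := core.
have nab : a != b by apply: contraTneq ab => ->; rewrite e_irr.
have cB : #|B| = t.+1.
  by rewrite !cardsU1 in_setU1 negb_or eq_sym nab bA aA cA0 !add1n prednK // ltnW.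
have LB v : v \in L -> v \notin B by move=> vL; apply: (split_core_memL core vL).
have nbL v : v \in L -> nbr e v \subset B.
  by case/two=> ->; [apply: subsetUr | apply/setUS/subsetUr].
have nLB v : v \notin B -> v \notin L -> v \notin L :|: B by rewrite in_setU negb_or => -> ->.
have Q_gt1 : 1 < #|L :|: B|.
  by apply: leq_trans (subset_leq_card (subsetUr L B)); rewrite cB ltnS ltnW.
have indep w w' : w \notin L :|: B -> w' \notin L :|: B -> ~~ e w w'.
  move=> wQ w'Q; apply/negP=> ww'.
  have [|x y xB yB|a' [b' [c [cc uc szc _ _]]]] :=
      @outer_edge_cycle (L :|: B) L B t.*2.-1 w w' erefl _ _ wQ w'Q ww' Q_gt1.
  - by move=> v /nbL; move=> h; apply: subset_trans h (subsetUr _ _).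
  - exact: split_core_conn.
  by have := leq_trans szc (circ cc uc); move: t_gt1; clear; lia.
split=> //; last first.
  exists u; first exact: LB.
  by rewrite nu; apply/subsetP=> v; rewrite !inE => /andP[/negPf->].
move=> v; rewrite inE => vB; have [vL|vL] := boolP (v \in L).
  split; first exact: nbL.
  case: (two v vL) => ->; rewrite cardsU1 ?aA ?bA cA0 add1n prednK //; exact: ltnW.
have vQ := nLB v vB vL.
have nbB : nbr e v \subset B.
  apply/subsetP=> w; rewrite inE => vw; apply/negPn/negP=> wB.
  have [wL|wL] := boolP (w \in L); last by have := indep v w vQ (nLB w wB wL); rewrite vw.
  by case/negP: vB; apply: (subsetP (nbL w wL)); rewrite inE e_sym.
split=> //; rewrite -ltnS -cB; apply: proper_card; rewrite properEneq nbB andbT.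
apply/negP=> /eqP E; have va : e v a by have: a \in nbr e v; [rewrite E !inE eqxx orbT | rewrite inE].
have vb : e v b by have: b \in nbr e v; [rewrite E !inE eqxx | rewrite inE].
have [z [pz uz lz sz kz]] := split_core_ab core.
have vz : v \notin a :: z by apply: contra vQ => /sz.
have nvb : v != b by apply: contraTneq vb => ->; rewrite e_irr.
have [|||||||c [cc uc szc]] := @glue_cycle V e e_sym v (a :: z) [:: b].
- by rewrite /= va.
- by rewrite /= vb.
- by [].
- by rewrite cons_uniq vz.
- by rewrite /= inE nvb.
- by [].
- by move=> x _; rewrite inE => /eqP.
have := circ cc uc; rewrite szc /=; move: kz; clear; lia.
Qed.


Section BipartiteCore.
Hypothesis min_deg : forall v, t <= #|nbr e v|.
Hypothesis tight_indep : forall L : {set V}, #|L| <= t ->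
  {in L, forall v, #|nbr e v| = t} -> {in L &, forall u v, ~~ e u v}.
Variables (L A : {set V}).
Hypotheses (cL : #|L| = t) (cA : #|A| = t) (nbL : {in L, forall u, nbr e u = A}).
Let Q := L :|: A.

Lemma core_edge u v : u \in L -> v \in A -> e u v.
Proof. by move=> uL vA; have: v \in nbr e u; [rewrite nbL | rewrite inE]. Qed.

Lemma core_disj u : u \in L -> u \notin A.
Proof. by move=> uL; apply/negP=> /(core_edge uL); rewrite e_irr. Qed.

Lemma core_notin u : u \notin Q -> u \notin L /\ u \notin A.
Proof. by rewrite inE negb_or => /andP. Qed.

Lemma core_conn : {in A &, forall x y, x != y -> conn e Q x y t.-1.*2}.
Proof.
move=> x y xA yA nxy; pose bs := rcons (enum (A :\ x :\ y)) y.
have sbs : size bs = t.-1.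
  rewrite size_rcons -cardE -cA [RHS](_ : _ = #|A :\ x|); last by rewrite (cardsD1 x A) xA.
  by rewrite [RHS](cardsD1 y) in_setD1 eq_sym nxy yA.
have subA : {subset bs <= A}.
  by move=> v; rewrite mem_rcons in_cons mem_enum !in_setD1 => /predU1P[->|/and3P[]].
have ubs : uniq bs by rewrite rcons_uniq enum_uniq mem_enum in_setD1 eqxx.
have szb : size bs <= size (enum L) by rewrite sbs -cardE cL leq_pred.
apply: (@conn_intro _ _ (alternate (enum L) bs)).
- apply: path_alternate => // [u v|].
    by rewrite mem_enum => uL /subA; apply: core_edge.
  by case E: (enum L) => [//|u us]; rewrite e_sym core_edge // -mem_enum E mem_head.
- rewrite cons_uniq uniq_alternate ?andbT.
    apply/negP=> /mem_alternate; rewrite mem_cat mem_enum => /orP[/core_disj/negP//|].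
    by rewrite mem_rcons in_cons mem_enum !in_setD1 eqxx (negPf nxy) andbF.
  rewrite cat_uniq enum_uniq ubs andbT; apply/hasPn=> v /subA vA.
  by apply: contraL vA; rewrite mem_enum; apply: core_disj.
- by rewrite last_alternate // last_rcons.
- move=> v; rewrite in_cons => /predU1P[->|/mem_alternate]; first by rewrite inE xA orbT.
  by rewrite mem_cat mem_enum inE => /orP[->//|/subA->]; rewrite orbT.
- by rewrite size_alternate // sbs.
Qed.

(** The cycle through the edge and the core has at least 2t + 1 vertices,
    which is the maximum, so both disjoint paths from the edge to the core
    have length one. *)
Lemma outer_edge w w' : w \notin Q -> w' \notin Q -> e w w' ->
  exists a b, [/\ a \in A, b \in A, a != b, e w a & e w' b].
Proof.
move=> wQ w'Q ww'.
have [||a [b [c [cc uc szc [aA bA nab] cab]]]] :=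
    @outer_edge_cycle Q L A t.-1.*2 w w' erefl _ core_conn wQ w'Q ww'.
- by move=> v /nbL->; apply: subsetUr.
- by apply: leq_trans (subset_leq_card (subsetUl L A)); rewrite cL.
have [|wa w'b] := cab; last by exists a, b.
by apply: leq_trans (circ cc uc) _; move: t_gt1; clear; lia.
Qed.

(** Closing the path through all of A gives a cycle with 2t - 1 vertices in
    the core besides the vertices of the path. *)
Lemma outer_path_short u p a b : path e u p -> uniq (u :: p) ->
    {in u :: p, forall v, v \notin Q} -> a \in A -> b \in A -> a != b ->
  e u a -> e (last u p) b -> size p <= 1.
Proof.
move=> pp up pQ aA bA nab ua lb.
have [z [pz uz lz sz kz]] := core_conn aA bA nab.
have [|||||||c [cc uc szc]] := @glue_cycle V e e_sym a (rcons (u :: p) b) z.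
- by rewrite rcons_path /= e_sym ua pp.
- by [].
- by rewrite last_rcons lz.
- rewrite cons_uniq rcons_uniq up mem_rcons in_cons negb_or nab /= andbT.
  by apply/andP; split; apply/negP=> /pQ; rewrite inE ?aA ?bA orbT.
- by [].
- by apply: leq_trans kz; move: t_gt1; clear; lia.
- move=> v; rewrite mem_rcons in_cons lz => /predU1P[//|/pQ vQ] vz.
  by case/negP: vQ; apply: sz; rewrite inE vz orbT.
have := circ cc uc; rewrite szc size_rcons /=; move: kz t_gt1; clear; lia.
Qed.

(** Let u, v, w be a path outside the core.  By the bounds on outer paths, u
    and w have the same single neighbour z in A, while v is adjacent to
    another vertex b of A, and v is the only neighbour of u outside the core.
    So u has degree two and t = 2: this is the exceptional configuration in
    which a split core, formed by u, a vertex of L, and z, b, v, appears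
    instead. *)
Lemma outer_cherry u v w : u \notin Q -> v \notin Q -> w \notin Q -> u != w ->
  e u v -> e v w -> exists L' A0 a b, split_core e t L' A0 a b.
Proof.
move=> uQ vQ wQ nuw uv vw.
have vu : e v u by rewrite e_sym.
have wv : e w v by rewrite e_sym.
have ne x y : e x y -> x != y by move=> xy; apply: contraTneq xy => ->; rewrite e_irr.
have cherry x y z a b : x \notin Q -> y \notin Q -> z \notin Q -> x != z ->
    e x y -> e y z -> a \in A -> b \in A -> e x a -> e z b -> a = b.
  move=> xQ yQ zQ nxz xy yz aA bA xa zb; apply/eqP/negPn/negP=> nab.
  have := @outer_path_short x [:: y; z] a b; rewrite /= xy yz !inE negb_or (ne _ _ xy) nxz (ne _ _ yz).
  move=> /(_ isT isT _ aA bA nab xa zb) H; suff: 2 <= 1 by []; apply: H => t'.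
  by rewrite 2!in_cons mem_seq1 => /or3P[] /eqP->.
have [z [b [zA bA nzb uz vb]]] := outer_edge uQ vQ uv.
have [c [z' [cA' z'A _ vc wz']]] := outer_edge vQ wQ vw.
have nbuA x : x \in A -> e u x -> x = z.
  move=> xA ux; have xz' := cherry u v w x z' uQ vQ wQ nuw uv vw xA z'A ux wz'.
  by rewrite xz' (cherry u v w z z' uQ vQ wQ nuw uv vw zA z'A uz wz').
have wz : e w z by rewrite (cherry u v w z z' uQ vQ wQ nuw uv vw zA z'A uz wz').
have nbu x : e u x -> x \notin Q -> x = v.
  move=> ux xQ; apply/eqP/negPn/negP=> nxv.
  have xu : e x u by rewrite e_sym.
  have [xw|nxw] := eqVneq x w.
    subst x; case/eqP: nzb; apply/esym.
    by apply: (cherry v u w b z vQ uQ wQ (ne _ _ vw) vu ux bA zA vb wz).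
  have [d [d' [dA d'A _ xd _]]] := outer_edge xQ uQ xu.
  have xb : e x b.
    by rewrite -(cherry x u v d b xQ uQ vQ nxv xu uv dA bA xd vb).
  have nbz : b != z by rewrite eq_sym.
  have := @outer_path_short x [:: u; v; w] b z.
  rewrite /= xu uv vw !inE !negb_or (ne _ _ xu) nxv nxw (ne _ _ uv) nuw (ne _ _ vw).
  move=> /(_ isT isT _ bA zA nbz xb wz) H; suff: 3 <= 1 by []; apply: H => t'.
  by rewrite 3!in_cons mem_seq1 => /or4P[] /eqP->.
have nu : nbr e u = [set v; z].
  apply/setP=> x; rewrite !inE; apply/idP/orP=> [ux|[] /eqP-> //].
  have [xL|xL] := boolP (x \in L).
    by case/negP: uQ; rewrite inE -(nbL xL) inE (e_sym x) ux orbT.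
  have [xA|xA] := boolP (x \in A); first by right; rewrite (nbuA x).
  by left; rewrite (nbu x) // inE negb_or xL.
have [vL vA] := core_notin vQ; have [uL uA] := core_notin uQ.
have nvz : v != z by apply: contraNneq vA => ->.
(* The two neighbours v and z of u exhaust its degree. *)
have t2 : t = 2.
  apply/eqP; rewrite eqn_leq t_gt1 andbT.
  by have := min_deg u; rewrite nu cards2 nvz.
have AE : A = [set b; z].
  by apply/esym/eqP; rewrite eqEcard subUset !sub1set bA zA cards2 eq_sym nzb cA t2.
have [l lL] : exists l, l \in L by apply/card_gt0P; rewrite cL t2.
have lQ : l \in Q by rewrite inE lL.
have nlu : l != u by apply: contraNneq uQ => <-.
have nlv : l != v by apply: contraNneq vQ => <-.
exists [set l; u], [set z], b, v; split.
- by rewrite cards2 nlu t2.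
- by rewrite cards1 t2.
- by rewrite e_sym.
- rewrite !inE eq_sym nzb nvz /=; apply/pred0Pn=> -[x] /=.
  rewrite !inE => /andP[/orP[]/eqP-> /or3P[]]; apply/negP => //.
  + by apply: contraTneq bA => <-; apply: core_disj.
  + by apply: contraTneq zA => <-; apply: core_disj.
  + exact: ne.
  + by apply: contraTneq bA => <-.
  + by apply: contraTneq zA => <-.
split.
- move=> x; rewrite !inE => /orP[]/eqP->; first by left; rewrite nbL.
  by right.
- by exists l; rewrite ?nbL ?inE ?eqxx.
- by exists u; rewrite ?inE ?eqxx ?orbT.
Qed.

Section Matching.
Hypothesis no_cherry : forall u v w, u \notin Q -> v \notin Q -> w \notin Q ->
  e u v -> e v w -> u = w.

(** Outside the core the edges now form a matching.  The two ends of an edge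
    do not both have degree t, and an end of larger degree is adjacent to its
    partner and to all of A. *)
Lemma outer_full w w' : w \notin Q -> w' \notin Q -> e w w' ->
  A \subset nbr e w \/ A \subset nbr e w'.
Proof.
move=> wQ w'Q ww'.
wlog wt : w w' wQ w'Q ww' / #|nbr e w| != t.
  have [wt|wt] := eqVneq #|nbr e w| t; last by apply.
  have [w't|w't] := eqVneq #|nbr e w'| t; last first.
    by move=> /(_ w' w); rewrite e_sym => /(_ w'Q wQ ww' w't)[]; [right|left].
  have := @tight_indep [set w; w'] _ _ w w'; rewrite !inE !eqxx orbT ww' => H _.
  suff: false by []; apply: H => //.
    by rewrite cards2; apply: leq_trans t_gt1; case: (w != w').
  by move=> v; rewrite !inE => /orP[] /eqP->.
left; have sub : nbr e w \subset w' |: A.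
  apply/subsetP=> v; rewrite !inE => wv; have [//|vA] := boolP (v \in A); first by rewrite orbT.
  have [vL|vL] := boolP (v \in L).
    by case/negP: wQ; rewrite inE -(nbL vL) inE (e_sym v) wv orbT.
  have vQ : v \notin Q by rewrite inE negb_or vL.
  by rewrite orbF; apply/eqP; apply: (no_cherry vQ wQ w'Q); rewrite // e_sym.
have [_ w'A] := core_notin w'Q.
have -> : nbr e w = w' |: A.
  by apply/eqP; rewrite eqEcard sub cardsU1 w'A cA add1n ltn_neqAle eq_sym wt min_deg.
exact: subsetUr.
Qed.

(** The core alone has cycles on 2t vertices.  Using the two edges in place of
    two vertices of L adds two vertices, because w and x, adjacent to all of
    A, behave like vertices of L. *)
Lemma two_outer_edges w w' x x' : uniq [:: w; w'; x; x'] ->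
    {in [:: w; w'; x; x'], forall v, v \notin Q} -> e w w' -> e x x' ->
    A \subset nbr e w -> A \subset nbr e x -> False.
Proof.
move=> uw wQ ww' xx' /subsetP fw /subsetP fx.
have [wQ1 w'Q1 xQ1 x'Q1] : [/\ w \notin Q, w' \notin Q, x \notin Q & x' \notin Q].
  by split; apply: wQ; rewrite !in_cons eqxx ?orbT.
have [_ [a [_ aA _ _ w'a]]] := outer_edge wQ1 w'Q1 ww'.
have [_ [c [_ cA' _ _ x'c]]] := outer_edge xQ1 x'Q1 xx'.
have wA y : y \in A -> e w y by move=> /fw; rewrite inE.
have xA y : y \in A -> e x y by move=> /fx; rewrite inE.
have w'w : e w' w by rewrite e_sym.
have x'x : e x' x by rewrite e_sym.
have nA v : v \notin Q -> v \notin A by case/core_notin.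
have nLQ v : v \notin Q -> v \notin enum L by rewrite mem_enum; case/core_notin.
have t1 : t.-1.+1 = t by apply: prednK; apply: ltnW.
have notin (v : V) (l bs : seq V) : v \notin l -> v \notin bs -> v \notin alternate l bs.
  by move=> vl vb; apply/negP=> /mem_alternate; rewrite mem_cat (negPf vl) (negPf vb).
have uls v : v \notin Q -> uniq (v :: enum L) by move=> vQ; rewrite cons_uniq enum_uniq nLQ.
have adj v : v \notin Q -> (forall y, y \in A -> e v y) -> {in v :: enum L & A, forall l b, e l b}.
  by move=> vQ vA l b; rewrite in_cons mem_enum => /predU1P[->|lL] bA; [apply: vA | apply: core_edge].
have neqA v y : v \notin Q -> y \in A -> (v == y) = false.
  by move=> /nA vA yA; apply: contraNF vA => /eqP->.
have neqL v y : v \notin Q -> y \in L -> (v == y) = false.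
  by move=> vQ yL; apply: contraNF vQ => /eqP->; rewrite inE yL.
have := uw; rewrite /= !inE !negb_or andbT => /and3P[/and3P[n1 n2 n3] /andP[n4 n5] n6].
have Ldisj l bs : {subset l <= [:: w; w'; x; x'] ++ enum L} -> {subset bs <= A} -> uniq l -> uniq bs ->
    uniq (alternate l bs).
  move=> lL bA ul ub; apply: uniq_alternate; rewrite cat_uniq ul ub andbT.
  apply/hasPn=> v /bA vA; apply: contraL vA => /lL; rewrite mem_cat mem_enum => /orP[/wQ/nA//|].
  exact: core_disj.
have [ca|nca] := eqVneq c a.
  rewrite {}ca in x'c cA'.
  pose bs := enum (A :\ a).
  have sbs : size bs = t.-1 by rewrite -cardE -cA (cardsD1 a A) aA.
  have subA : {subset bs <= A} by move=> v; rewrite mem_enum in_setD1 => /andP[].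
  have szb : size bs <= size (w :: enum L) by rewrite sbs /= -cardE cL; case: (t) => // n; apply: ltnW.
  have lb : last w' bs \in A.
    apply: subA; move: sbs; case: (bs) => [|b0 bs0 _]; last by rewrite /= mem_last.
    by move: t_gt1; clear; case: t => [|[]].
  have p1 : path e w' (alternate (w :: enum L) bs).
    by apply: path_alternate => // l b lL /subA; apply: (adj w).
  have u1 : uniq (alternate (w :: enum L) bs).
    apply: Ldisj => //; rewrite ?enum_uniq ?uls // => v.
    by rewrite in_cons mem_cat => /predU1P[->|->]; rewrite ?orbT // mem_head.
  have abs : a \notin bs by rewrite mem_enum in_setD1 eqxx.
  have outN v : v \notin Q -> v != w -> v \notin alternate (w :: enum L) bs.
    move=> vQ vw; apply: notin; first by rewrite in_cons negb_or vw nLQ.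
    by apply: contra (nA v vQ) => /subA.
  have aalt : a \notin alternate (w :: enum L) bs.
    apply: (notin a (w :: enum L) bs) => //; rewrite in_cons negb_or eq_sym neqA //= mem_enum.
    by apply: contraL aA; apply: core_disj.
  (* Both edges are attached to a: the cycle leaves a through w', w and returns
     through x, x'. *)
  have: size (w' :: alternate (w :: enum L) bs ++ [:: x; x'; a]) <= t.*2.+1; [apply: circ|].
  - rewrite /= rcons_cat cat_path p1 /= last_alternate // (e_sym _ x) xA //= xx' x'c.
    by rewrite e_sym w'a.
  - rewrite -cat_cons cat_uniq cons_uniq outN // 1?eq_sym // u1 andTb.
    rewrite /= !inE !negb_or n6 !(eq_sym x) !(eq_sym x') !(eq_sym a) n4 n5.
    rewrite !(neqA _ _ _ aA) // aalt !outN //= ?andbT; by rewrite eq_sym.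
  - rewrite /= size_cat size_alternate // sbs /= => c0; move: c0 t_gt1; clear; lia.
pose bs := rcons (enum (A :\ a :\ c)) a.
have sbs : size bs = t.-1.
  rewrite size_rcons -cardE -cA [RHS](_ : _ = #|A :\ a|); last by rewrite (cardsD1 a A) aA.
  by rewrite [RHS](cardsD1 c) in_setD1 nca cA'.
have subA : {subset bs <= A}.
  by move=> v; rewrite mem_rcons in_cons mem_enum !in_setD1 => /predU1P[->|/and3P[]].
have ubs : uniq bs by rewrite rcons_uniq enum_uniq mem_enum !in_setD1 eqxx andbF.
have szb : size bs <= size (x :: enum L) by rewrite sbs /= -cardE cL; case: (t) => // n; apply: ltnW.
have p1 : path e x' (alternate (x :: enum L) bs).
  by apply: path_alternate => // l b lL /subA; apply: (adj x).
have u1 : uniq (alternate (x :: enum L) bs).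
  apply: Ldisj => //; rewrite ?uls // => v.
  by rewrite in_cons mem_cat => /predU1P[->|->]; rewrite ?orbT // !inE eqxx !orbT.
have cbs : c \notin bs by rewrite mem_rcons in_cons negb_or nca mem_enum in_setD1 eqxx.
have outN v : v \notin Q -> v != x -> v \notin alternate (x :: enum L) bs.
  move=> vQ vx; apply: notin; first by rewrite in_cons negb_or vx nLQ.
  by apply: contra (nA v vQ) => /subA.
have calt : c \notin alternate (x :: enum L) bs.
  apply: (notin c (x :: enum L) bs) => //; rewrite in_cons negb_or eq_sym neqA //= mem_enum.
  by apply: contraL cA'; apply: core_disj.
(* The cycle contains a, w', w, c, x', x in this order and then alternates
   between A and L back to a, the last entry of bs. *)
have: size [:: w', w, c, x' & alternate (x :: enum L) bs] <= t.*2.+1; [apply: circ|].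
- rewrite /= rcons_path p1 last_alternate // last_rcons w'w wA //= e_sym x'c.
  by rewrite e_sym w'a.
- rewrite !cons_uniq !in_cons !negb_or u1 calt !outN //; try by rewrite eq_sym.
  rewrite !(eq_sym w') !(eq_sym c) n1 n3 !(neqA _ _ _ cA') // eq_sym n5 /= ?andbT //.
- rewrite -[size _]/(size (alternate (x :: enum L) bs)).+4 size_alternate // sbs => c0; move: c0 t_gt1; clear; lia.
Qed.

End Matching.

Lemma bipartite_core_structure :
  (exists L' A0 a b, split_core e t L' A0 a b) \/
  (exists w w', forall u v, u \notin A -> v \notin A -> e u v ->
     u = w /\ v = w' \/ u = w' /\ v = w).
Proof.
have [/existsP[u /existsP[v /existsP[w /and5P[uQ vQ wQ nuw /andP[uv vw]]]]]|nc] :=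
  boolP [exists u, exists v, exists w,
    [&& u \notin Q, v \notin Q, w \notin Q, u != w & e u v && e v w]].
  by left; apply: (outer_cherry uQ vQ wQ nuw uv vw).
right.
have no_cherry u v w : u \notin Q -> v \notin Q -> w \notin Q -> e u v -> e v w -> u = w.
  move=> uQ vQ wQ uv vw; apply/eqP; apply: contraNT nc => nuw.
  apply/existsP; exists u; apply/existsP; exists v; apply/existsP; exists w.
  by rewrite uQ vQ wQ nuw uv vw.
have out u v : u \notin A -> v \notin A -> e u v -> u \notin Q /\ v \notin Q.
  move=> uA vA uv; rewrite !inE !negb_or uA vA !andbT; split; apply/negP=> xL.
    by case/negP: vA; rewrite -(nbL xL) inE.
  by case/negP: uA; rewrite -(nbL xL) inE e_sym.
have [/existsP[w /existsP[w' /and3P[wA w'A ww']]]|ne] :=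
  boolP [exists w, exists w', [&& w \notin A, w' \notin A & e w w']]; last first.
  have [x _] : exists x, x \in A by apply/card_gt0P; rewrite cA ltnW.
  exists x, x => u v uA vA uv; case/existsP: ne; exists u; apply/existsP; exists v.
  by rewrite uA vA.
have [wQ w'Q] := out w w' wA w'A ww'.
exists w, w' => x x' xA x'A xx'.
have [xQ x'Q] := out x x' xA x'A xx'.
have w'w : e w' w by rewrite e_sym.
have x'x : e x' x by rewrite e_sym.
have [xw|nxw] := eqVneq x w.
  by left; subst x; split=> //; apply: (no_cherry x' w w').
have [xw'|nxw'] := eqVneq x w'.
  by right; subst x; split=> //; apply: (no_cherry x' w' w).
have nx'w : x' != w.
  by apply: contraNneq nxw' => E; subst x'; apply/eqP; apply: (no_cherry x w w').
have nx'w' : x' != w'.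
  by apply: contraNneq nxw => E; subst x'; apply/eqP; apply: (no_cherry x w' w).
have nww' : w != w' by apply: contraTneq ww' => ->; rewrite e_irr.
have nxx' : x != x' by apply: contraTneq xx' => ->; rewrite e_irr.
exfalso.
wlog fw : w w' wA w'A ww' wQ w'Q w'w nxw nxw' nx'w nx'w' nww' / A \subset nbr e w => [H|].
  have [fw|fw'] := outer_full no_cherry wQ w'Q ww'; first exact: (H w w').
  by apply: (H w' w) => //; rewrite eq_sym.
wlog fx : x x' xA x'A xx' xQ x'Q x'x nxw nxw' nx'w nx'w' nxx' / A \subset nbr e x => [H|].
  have [fx|fx'] := outer_full no_cherry xQ x'Q xx'; first exact: (H x x').
  by apply: (H x' x) => //; rewrite eq_sym.
apply: (@two_outer_edges w w' x x') => //.
  rewrite /= !inE !negb_or nww' nxx' !andbT.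
  by rewrite !(eq_sym w) !(eq_sym w') nxw nx'w nxw' nx'w'.
by move=> v; rewrite 3!in_cons mem_seq1 => /or4P[] /eqP->.
Qed.

End BipartiteCore.

End Cores.

(** * Edge counts and Turan's theorem *)

Section Counting.

Lemma adj_graph_of_rel (V : finType) (e : rel V) x y :
  adj (graph_of_rel e) x y = (x != y) && (e x y || e y x).
Proof.
rewrite /adj inE; apply/existsP/andP=> [[a /existsP[b /and3P[ab eab /eqP E]]]|[xy exy]].
  have ax : a \in [set x; y] by rewrite E !inE eqxx.
  have bx : b \in [set x; y] by rewrite E !inE eqxx orbT.
  move: ax bx ab eab; rewrite !inE => /orP[]/eqP-> /orP[]/eqP->; rewrite ?eqxx // => ne ->;
  by rewrite ?orbT //; rewrite eq_sym ne.
case/orP: exy => exy; [exists x; apply/existsP; exists y|exists y; apply/existsP; exists x].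
  by rewrite xy exy eqxx.
by rewrite eq_sym xy exy setUC eqxx.
Qed.

Variables (V : finType) (G : sgraph V).
Implicit Types (U L S : {set V}).

Lemma adj_sym : symmetric (adj G).
Proof. by move=> x y; rewrite /adj setUC. Qed.

Lemma adj_irr : irreflexive (adj G).
Proof.
move=> x; apply/negP=> xx; have /'forall_implyP/(_ _ xx) := edges_card2 G.
by rewrite cards2 eqxx.
Qed.

Local Notation nbr := (nbr (adj G)).

Definition edges_within U := #|[set E in edges G | E \subset U]|.

Lemma edges_within_setT : edges_within setT = num_edges G.
Proof. by apply: eq_card => E; rewrite !inE subsetT andbT. Qed.

Lemma edges_within0 : edges_within set0 = 0.
Proof.
apply/eqP; rewrite cards_eq0 -subset0; apply/subsetP=> E; rewrite !inE subset0.
case/andP=> EG /eqP E0; have /'forall_implyP/(_ _ EG) := edges_card2 G.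
by rewrite E0 cards0.
Qed.

Lemma edges_within_rem U v : v \in U ->
  edges_within U = edges_within (U :\ v) + #|nbr v :&: U|.
Proof.
move=> vU; pose E1 := [set E in edges G | E \subset U :\ v].
pose E2 := [set [set v; y] | y in nbr v :&: U].
have -> : edges_within U = #|E1 :|: E2|.
  apply: eq_card => E; rewrite !inE; apply/andP/orP.
    case=> EG EU; have [vE|vE] := boolP (v \in E); last by left; rewrite EG subsetD1 EU.
    right; have /'forall_implyP/(_ _ EG)/cards2P[a [b [ab Eab]]] := edges_card2 G.
    wlog av : a b ab Eab / a = v.
      move=> H; have: v \in [set a; b] by rewrite -Eab.
      rewrite !inE => /orP[] /eqP va; first exact: (H a b ab Eab (esym va)).
      by apply: (H b a) => //; rewrite ?Eab ?va 1?eq_sym // setUC.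
    apply/imsetP; exists b; last by rewrite Eab av.
    rewrite !inE /adj -av -Eab EG; apply: (subsetP EU).
    by rewrite Eab !inE eqxx orbT.
  case=> [/andP[-> EU]|/imsetP[y]].
    by split=> //; apply: subset_trans EU (subsetDl _ _).
  by rewrite !inE => /andP[vy yU] ->; rewrite subUset !sub1set vU yU.
have -> : #|nbr v :&: U| = #|E2|.
  rewrite card_in_imset // => y z; rewrite !inE => /andP[vy _] /andP[vz _] /setP/(_ y).
  rewrite !inE eqxx orbT => /esym/orP[/eqP yv|/eqP //].
  by rewrite yv adj_irr in vy.
rewrite cardsU (_ : E1 :&: E2 = set0) ?cards0 ?subn0 //.
apply/setP=> E; rewrite !inE; apply/negP=> /andP[/andP[_]] EU /imsetP[y _ Ey].
by have := subsetP EU v; rewrite Ey !inE !eqxx => /(_ isT).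
Qed.

Lemma edges_within_cut U1 U2 :
    (forall x y, x \in U1 :\: U2 -> y \in U2 :\: U1 -> ~~ adj G x y) ->
  edges_within (U1 :|: U2) <= edges_within U1 + edges_within U2.
Proof.
move=> cut; apply: leq_trans (leq_card_setU _ _); apply: subset_leq_card.
apply/subsetP=> E; rewrite !inE => /andP[EG EU]; rewrite EG /=.
have /'forall_implyP/(_ _ EG)/cards2P[a [b [ab Eab]]] := edges_card2 G.
have aab : adj G a b by rewrite /adj -Eab.
have [aU bU] : a \in U1 :|: U2 /\ b \in U1 :|: U2.
  by move: EU; rewrite Eab subUset !sub1set => /andP.
have := cut a b; have := cut b a; rewrite (adj_sym b) aab Eab !subUset !sub1set !inE.
move: aU bU; rewrite !inE.
by case: (a \in U1); case: (a \in U2); case: (b \in U1); case: (b \in U2) => // _ _ H1 H2;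
  (try by have := H1 isT isT); have := H2 isT isT.
Qed.

Lemma edges_within_del U L (d : V -> nat) : L \subset U ->
    {in L, forall v, #|nbr v :&: U| <= d v} ->
  edges_within U <= edges_within (U :\: L) + \sum_(v in L) d v.
Proof.
move: {2}#|L| (erefl #|L|) => n; elim: n U L => [|n IHn] U L.
  by move/eqP; rewrite cards_eq0 => /eqP-> _ _; rewrite setD0 big_set0 addn0.
move=> cL LU dL; have [v vL] : exists v, v \in L by apply/card_gt0P; rewrite cL.
have vU := subsetP LU v vL.
rewrite (edges_within_rem vU) (big_setD1 v) //= addnCA addnC leq_add ?dL //.
have -> : U :\: L = (U :\ v) :\: (L :\ v) by rewrite setDDl setD1K.
apply: IHn; first by move: cL; rewrite (cardsD1 v) vL => -[].
  by apply: setSD.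
move=> w; rewrite inE => /andP[_ wL]; apply: leq_trans (dL w wL).
by apply/subset_leq_card/setIS/subD1set.
Qed.

(** An edge inside L is counted twice in the sum of the degrees. *)
Lemma edges_within_del_adj L (d : V -> nat) u v : u \in L -> v \in L -> adj G u v ->
    {in L, forall v, #|nbr v| <= d v} ->
  edges_within setT < edges_within (~: L) + \sum_(v in L) d v.
Proof.
move=> uL vL uv dL; have nuv : v != u by apply: contraTneq uv => ->; rewrite adj_irr.
rewrite (edges_within_rem (in_setT u)) (big_setD1 u) //= addnCA addnC -addnS.
rewrite leq_add //; first by rewrite setIT dL.
(* After the deletion of u, the degree of v has dropped by one. *)
pose d' x := if x == v then (d v).-1 else d x.
have vLu : v \in L :\ u by rewrite in_setD1 nuv.
have dv : 0 < d v.
  apply: leq_trans (dL v vL); apply/card_gt0P; exists u; by rewrite inE adj_sym.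
have -> : ~: L = (setT :\ u) :\: (L :\ u) by rewrite setDDl setD1K // setTD.
apply: leq_trans (_ : (edges_within ((setT :\ u) :\: (L :\ u)) + \sum_(x in L :\ u) d' x).+1 <= _).
  rewrite ltnS; apply: edges_within_del; first by apply: setSD; apply: subsetT.
  move=> w; rewrite in_setD1 => /andP[wu wL]; rewrite /d'; case: eqP => [->|_].
    rewrite -ltnS prednK //; apply: leq_trans (dL v vL); apply: proper_card.
    rewrite properE subsetIl /=; apply/subsetPn; exists u; first by rewrite inE adj_sym.
    by rewrite !inE eqxx /= andbF.
  by apply: leq_trans (dL w wL); apply/subset_leq_card/subsetIl.
rewrite -addnS leq_add2l (big_setD1 v) //= [X in _ <= X](big_setD1 v) //= /d' eqxx -addSn prednK // leq_add2l.
rewrite leq_eqVlt; apply/orP; left; apply/eqP; apply: eq_bigr => x.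
by rewrite in_setD1 => /andP[/negPf->].
Qed.

Definition clique S := [forall x in S, forall y in S, (x != y) ==> adj G x y].

Lemma cliqueP S : reflect {in S &, forall x y, x != y -> adj G x y} (clique S).
Proof.
apply: (iffP 'forall_implyP) => [H x y xS yS xy | H x xS].
  by have /'forall_implyP/(_ y yS)/implyP := H x xS; apply.
by apply/'forall_implyP=> y yS; apply/implyP; apply: H.
Qed.

Lemma clique_add S v : clique S -> {in S, forall x, adj G v x} ->
  clique (v |: S) /\ #|v |: S| = #|S|.+1.
Proof.
move=> /cliqueP cS vS; split.
  apply/cliqueP=> x y; rewrite !inE => /predU1P[->|xS] /predU1P[->|yS]; rewrite ?eqxx // => xy.
  - exact: vS.
  - by rewrite adj_sym vS.
  - exact: cS.
by rewrite cardsU1; case: (boolP (v \in S)) => // /vS; rewrite adj_irr.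
Qed.

(** The number of edges of the Turan graph, counted from the vertices to their
    predecessors: j has the same residue as j / s smaller vertices. *)
Definition turan_size m s := \sum_(j < m) (j - j %/ s).

(** If every vertex missed at most m / s vertices, itself included, then s
    vertices could not exhaust all m + 1, and a clique could be extended
    greedily to s + 1 vertices. *)
Lemma low_degree U s : 0 < s -> 0 < #|U| ->
    (forall S, S \subset U -> clique S -> #|S| <= s) ->
  exists2 v, v \in U & #|nbr v :&: U| <= #|U|.-1 - #|U|.-1 %/ s.
Proof.
move=> s_gt0 U_gt0 noK; set m := #|U|.-1; have mU : #|U| = m.+1 by rewrite prednK.
apply/exists_inP; apply: contraT => /exists_inPn high.
(* The set of vertices missed by v contains v itself. *)
have miss v : v \in U -> #|U :\: nbr v| <= m %/ s.
  move=> vU; have := high v vU; rewrite -ltnNge cardsD mU setIC.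
  have := leq_div m s; move: (m %/ s) => q; clear; lia.
suff [S [SU cS szS]] : exists S, [/\ S \subset U, clique S & #|S| = s.+1].
  by have := noK S SU cS; rewrite szS ltnn.
suff: forall i, i <= s.+1 -> exists S, [/\ S \subset U, clique S & #|S| = i] by apply.
elim=> [|i IHi] i_le.
  exists set0; rewrite sub0set cards0; split=> //.
  by apply/cliqueP=> x y; rewrite inE.
have [S [SU cS szS]] := IHi (ltnW i_le).
have cov : #|\bigcup_(v in S) (U :\: nbr v)| <= i * (m %/ s).
  rewrite -szS -sum_nat_const.
  apply: (big_ind2 (fun (A : {set V}) n => #|A| <= n)) => [|A a B b Aa Bb|v vS].
  - by rewrite cards0.
  - by apply: leq_trans (leq_card_setU _ _) (leq_add Aa Bb).
  - by apply: miss; apply: (subsetP SU).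
have [w] : exists w, w \in U :\: \bigcup_(v in S) (U :\: nbr v).
  apply/card_gt0P; rewrite cardsD subn_gt0.
  apply: leq_ltn_trans (subset_leq_card (subsetIr _ _)) _.
  apply: leq_ltn_trans cov _; rewrite mU ltnS.
  apply: leq_trans (_ : s * (m %/ s) <= m); first by apply: leq_mul; [exact: i_le | exact: leqnn].
  by rewrite mulnC leq_trunc_div.
rewrite inE => /andP[/bigcupP wN wU].
have wS : {in S, forall x, adj G w x}.
  move=> x xS; apply/negPn/negP=> wx; case: wN; exists x => //.
  by rewrite !inE adj_sym wx.
have [cwS szwS] := clique_add cS wS.
by exists (w |: S); rewrite subUset sub1set wU SU szwS szS.
Qed.

(** Delete a vertex of low degree: the bound of [low_degree] is exactly the
    increment of [turan_size]. *)
Theorem turan_bound U s : 0 < s -> (forall S, S \subset U -> clique S -> #|S| <= s) ->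
  edges_within U <= turan_size #|U| s.
Proof.
move=> s_gt0; move: {2 3}#|U| (erefl #|U|) => m; elim: m U => [|m IHm] U cU noK.
  by move/eqP: cU; rewrite cards_eq0 => /eqP->; rewrite edges_within0.
have [v vU dv] : exists2 v, v \in U & #|nbr v :&: U| <= #|U|.-1 - #|U|.-1 %/ s.
  by apply: low_degree; rewrite // cU.
rewrite (edges_within_rem vU) /turan_size big_ord_recr /= leq_add //.
  apply: IHm; first by move: cU; rewrite (cardsD1 v) vU => -[].
  by move=> S SU; apply: noK; apply: subset_trans SU (subsetDl _ _).
by rewrite cU in dv.
Qed.

End Counting.

(** Edge counts are determined by degrees into smaller sets, which an
    embedding preserves. *)
Lemma edges_within_imset (T V : finType) (H : sgraph T) (G : sgraph V) (g : T -> V)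
    (S : {set T}) :
    injective g -> (forall x y, adj H x y = adj G (g x) (g y)) ->
  edges_within H S = edges_within G (g @: S).
Proof.
move=> g_inj adjH; move: {2}#|S| (erefl #|S|) => m; elim: m S => [|m IHm] S.
  by move/eqP; rewrite cards_eq0 => /eqP->; rewrite imset0 !edges_within0.
move=> cS; have [v vS] : exists v, v \in S by apply/card_gt0P; rewrite cS.
rewrite (edges_within_rem H vS) (@edges_within_rem V G (g @: S) (g v)); last exact: imset_f.
have -> : g @: S :\ g v = g @: (S :\ v).
  apply/setP=> x; rewrite in_setD1; apply/andP/imsetP=> [[xv /imsetP[y yS E]]|[y]].
    by exists y; rewrite // in_setD1 yS andbT; apply: contraNneq xv => <-; rewrite E.
  by rewrite in_setD1 => /andP[yv yS] ->; rewrite (inj_eq g_inj) imset_f.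
rewrite IHm; last by move: cS; rewrite (cardsD1 v) vS => -[].
congr (_ + _); rewrite -(card_imset _ g_inj); apply: eq_card => x.
rewrite inE; apply/imsetP/andP=> [[y]|[]].
  by rewrite !inE adjH => /andP[vy yS] ->; rewrite imset_f.
by rewrite inE => vx /imsetP[y yS E]; exists y; rewrite ?inE ?adjH // -E vx.
Qed.

Section TuranSize.

Lemma turan_size_recr m s : turan_size m.+1 s = turan_size m s + (m - m %/ s).
Proof. by rewrite /turan_size big_ord_recr. Qed.

Lemma turan_size_le m s : (turan_size m s).*2 <= m * m.-1.
Proof.
elim: m => [|m IHm]; first by rewrite /turan_size big_ord0.
rewrite turan_size_recr doubleD; have := leq_subr (m %/ s) m.
case: m IHm => [|m] IHm h //=; first by rewrite div0n /turan_size big_ord0.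
move: IHm h => /=; nia.
Qed.

Lemma turan_size_ltS t s : 0 < s -> s < t -> turan_size t s < turan_size t s.+1.
Proof.
move=> s_gt0 st; rewrite /turan_size (bigD1 (Ordinal st)) //= [X in _ < X](bigD1 (Ordinal st)) //=.
rewrite -addSn leq_add //.
  by rewrite divnn s_gt0 divn_small // subn0; case: s s_gt0 {st} => // s _; rewrite subn1.
by apply: leq_sum => j _; apply: leq_sub2l; apply: leq_div2l.
Qed.

Lemma turan_size_small t n : 0 < t -> n <= t.*2 ->
  (turan_size n t).*2 + (n - t).*2 = n * n.-1.
Proof.
move=> t_gt0; elim: n => [|n IHn] nt; first by rewrite /turan_size big_ord0.
rewrite turan_size_recr; have := IHn (ltnW nt).
have [nlt|nge] := ltnP n t.
  rewrite divn_small // subn0; case: n nlt {IHn nt} => [|n] nlt /=; first by rewrite /turan_size big_ord0; move: t_gt0; clear; lia.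
  by have -> : n.+1 - t = 0 by [move: nlt; clear; lia]; have -> : n.+2 - t = 0 by [move: nlt; clear; lia]; move: (turan_size _ _) => ?; nia.
have -> : n %/ t = 1.
  apply/eqP; rewrite eqn_leq leq_divRL // mul1n nge andbT -ltnS ltn_divLR //.
  by move: nt; rewrite mul2n.
case: n nge nt {IHn} => [|n] nge nt /=; first by move: nge t_gt0; clear; lia.
move: (turan_size _ _) => T; rewrite subn1 /=.
by move: nge; nia.
Qed.

(** Below 2t vertices even a complete graph is sparse enough; for 2t and 2t +
    1 vertices the missing edges of the Turan graph are needed. *)
Lemma turan_size_block t n : 1 < t -> 1 < n -> n <= t.*2.+1 -> turan_size n t < t * n.-1.
Proof.
move=> t_gt1 n_gt1; rewrite leq_eqVlt ltnS => /orP[/eqP->|nt].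
  have := @turan_size_small t t.*2 (ltnW t_gt1) (leqnn _).
  have d : t.*2 %/ t = 2 by rewrite -mul2n mulnK // ltnW.
  rewrite turan_size_recr d /=; move: (turan_size _ _) => T; move: t_gt1; clear.
  case: t => [|[|t]] // _; rewrite -!muln2 -!subn1; nia.
have := @turan_size_small t n (ltnW t_gt1) nt.
move: (turan_size _ _) => T; case: n n_gt1 nt => [|n] //= n_gt1 nt.
move: t_gt1 nt n_gt1; clear; rewrite -!muln2; nia.
Qed.

End TuranSize.

(** * The shape of tight graphs *)

Section Structure.

(** The ends of the only edge that may occur outside A are w and w'; when
    there is no such edge they are arbitrary vertices. *)
Definition one_edge_shape (V : finType) (e : rel V) t :=
  exists (A : {set V}) l w w', [/\ #|A| = t, nbr e l = A &
    forall u v, u \notin A -> v \notin A -> e u v ->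
      u = w /\ v = w' \/ u = w' /\ v = w].

(** B is the common neighbourhood enlarged by one vertex: it has t + 1
    elements, but every vertex outside B sees at most t of them. *)
Definition split_shape (V : finType) (e : rel V) t :=
  exists (B : {set V}) b l, [/\ #|B| = t.+1, b \in B,
    {in ~: B, forall v, nbr e v \subset B /\ #|nbr e v| <= t} &
    l \notin B /\ B :\ b \subset nbr e l].

(** The core is split if some longest path to y has a neighbour of its first
    vertex in position 2t, counted from 0, and bipartite otherwise; a
    bipartite core may still turn into a split one when t = 2. *)
Theorem tight_structure (V : finType) (e : rel V) t :
    symmetric e -> irreflexive e -> no_cutvertex e -> 1 < t ->
    (forall c, cycle e c -> uniq c -> size c <= t.*2.+1) -> t.*2.+1 < #|V| ->
    (forall v, t <= #|nbr e v|) ->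
    (forall L : {set V}, #|L| <= t -> {in L, forall v, #|nbr e v| = t} ->
       {in L &, forall u v, ~~ e u v}) ->
  one_edge_shape e t \/ split_shape e t.
Proof.
move=> e_sym e_irr cutfree t_gt1 circ card_gt min_deg tight.
have split_case L A0 a b : split_core e t L A0 a b -> split_shape e t.
  move/(split_core_structure e_sym e_irr cutfree t_gt1 circ)=> [cB degB [l lB lb]].
  by exists (b |: (a |: A0)), b, l; rewrite setU11.
have [y [y_end head_deg]] := exists_end e_sym e_irr cutfree t_gt1 circ card_gt min_deg.
have [[s [w [ys xw wN]]]|nlong] := boolp.EM
    (exists s w, [/\ longest_to e y s, e (head y s) w & w \notin take t.*2 s]).
  right; have [L [A0 [a [b core]]]] :=
    split_core_of_long e_sym e_irr t_gt1 circ tight head_deg ys xw wN.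
  exact: split_case core.
have short s w : longest_to e y s -> e (head y s) w -> w \in take t.*2 s.
  by move=> ys xw; apply/negPn/negP=> wN; case: nlong; exists s, w.
have [L [A [cL cA nbL]]] := bipartite_core e_sym e_irr t_gt1 circ tight y_end head_deg short.
have [[L' [A0 [a [b core]]]]|[w [w' out]]] :=
    bipartite_core_structure e_sym e_irr cutfree t_gt1 circ min_deg tight cL cA nbL.
  by right; apply: split_case core.
have [l lL] : exists l, l \in L by apply/card_gt0P; rewrite cL ltnW.
by left; exists A, l, w, w'; rewrite nbL.
Qed.

End Structure.

(** * The upper bound *)

Section UpperBound.

Variables (t s : nat).
Hypotheses (s_gt0 : 0 < s) (st : s < t).

Lemma t_gt1 : 1 < t. Proof. exact: leq_ltn_trans s_gt0 st. Qed.

(** How much the bound of the theorem falls short of t (n - 1). *)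
Definition defect := t * t.-1 - turan_size t s.

Definition ceil_div m := (m + t.*2.+1) %/ t.*2.+2.

(** The gain over t (|U| - 1) that is maintained in the induction.  Components
    and blocks force it to be subadditive; the step length 2t + 2 is large
    enough to absorb the sets that are deleted and small enough to reach
    [defect] within k^3 / 4 vertices. *)
Definition slack m := minn defect (ceil_div m).

Lemma ceil_div_le m k : (ceil_div m <= k) = (m <= k * t.*2.+2).
Proof.
rewrite /ceil_div -ltnS ltn_divLR // mulSn; move: (k * _) => a.
by apply/idP/idP; lia.
Qed.

Lemma ceil_divD a b : ceil_div (a + b) <= ceil_div a + ceil_div b.
Proof. by rewrite ceil_div_le mulnDl leq_add // -ceil_div_le. Qed.

Lemma ceil_div_small m : m <= t.*2.+2 -> ceil_div m <= 1.
Proof. by rewrite ceil_div_le mul1n. Qed.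

Lemma slackD a b : slack (a + b) <= slack a + slack b.
Proof. by have := ceil_divD a b; rewrite /slack; lia. Qed.

Lemma slack_add a b : b <= t.*2.+2 -> slack (a + b) <= (slack a).+1.
Proof. by move=> /ceil_div_small; have := ceil_divD a b; rewrite /slack; lia. Qed.

Lemma turan_size_defect : turan_size t s + defect = t * t.-1.
Proof.
rewrite subnKC //; have := turan_size_le t s; move: (turan_size _ _) (t * _) => a b.
by clear; lia.
Qed.

Section Step.
Variables (V : finType) (G : sgraph V).
Let e := adj G.
Let e_sym : symmetric e := adj_sym G.
Let e_irr : irreflexive e := adj_irr G.
Hypothesis noK : forall S, clique G S -> #|S| <= s.+1.
Hypothesis circ : forall c, cycle e c -> uniq c -> size c <= t.*2.+1.

Definition sparse (U : {set V}) := edges_within G U + slack #|U|.-1 <= t * #|U|.-1.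

Hypothesis IH : forall U : {set V}, U != set0 -> U != setT -> sparse U.

Let nsetT (U : {set V}) : U != set0 -> ~: U != setT.
Proof. by move=> U0; rewrite -setC0 (inj_eq (@setC_inj _)). Qed.

Lemma common_nbr_turan (U : {set V}) l : U \subset nbr e l -> 
  edges_within G U <= turan_size #|U| s.
Proof.
move=> Ul; apply: turan_bound => // S SU cS; rewrite -ltnS.
have [|cl <-] := clique_add (v := l) cS; last exact: noK.
by move=> x xS; have := subsetP Ul x (subsetP SU x xS); rewrite inE.
Qed.

(** In the split shape, B minus b has a common neighbour l outside, so it
    spans at most as many edges as T(t, s), and b adds at most t.  In the
    other shape a possible edge between w and w' is paid for: either w or w'
    is not adjacent to all of A, or A contains not even a clique on s
    vertices, which costs an edge because T(t, s - 1) has fewer edges than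
    T(t, s). *)
Lemma structure_bound : t.*2.+1 < #|V| ->
  one_edge_shape e t \/ split_shape e t ->
  edges_within G setT <= t * (#|V| - t) + turan_size t s.
Proof.
move=> nV [[A [l [w [w' [cA nl out]]]]]|[B [b [l [cB bB nbB [lB lb]]]]]]; last first.
  have := @edges_within_del V G setT (~: B) (fun=> t) (subsetT _).
  rewrite setTD setCK sum_nat_const => H.
  have {}H := H (fun v vB => leq_trans (subset_leq_card (subsetIl _ _)) (nbB v vB).2).
  apply: leq_trans H _; rewrite cardsCs setCK cB (edges_within_rem G bB).
  have := common_nbr_turan lb.
  have -> : #|B :\ b| = t by move: cB; rewrite (cardsD1 b) bB => -[].
  have : #|nbr (adj G) b :&: B| <= t.
    rewrite -ltnS -cB; apply: proper_card; rewrite properE subsetIr /=.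
    by apply/subsetPn; exists b; rewrite // !inE adj_irr.
  have -> : #|V| - t = (#|V| - t.+1).+1 by move: nV; clear; lia.
  rewrite mulnS mulnC; move: (_ * _) => a; clear; lia.
have subA v : v \notin A -> ~~ [&& w \notin A, w' \notin A & e w w'] || (v != w) && (v != w') -> nbr e v \subset A.
  move=> vA cond; apply/subsetP=> u; rewrite inE => vu; apply/negPn/negP=> uA.
  have uv : e u v by rewrite /e adj_sym.
  case: (out v u vA uA vu) => -[E1 E2]; subst; move: cond; rewrite ?eqxx ?andbF orbF.
    by rewrite vA uA vu.
  by rewrite vA uA uv.
have tA : edges_within G A <= turan_size t s.
  by rewrite -cA; apply: (@common_nbr_turan A l); rewrite nl.
have cCA : #|~: A| = #|V| - t by rewrite cardsCs setCK cA.
have [/and3P[wA w'A ww']|noedge] := boolP [&& w \notin A, w' \notin A & e w w']; last first.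
  have := @edges_within_del V G setT (~: A) (fun=> t) (subsetT _).
  rewrite setTD setCK sum_nat_const cCA => H.
  apply: leq_trans (H _) _; last by rewrite addnC leq_add // mulnC.
  move=> v; rewrite inE => vA; rewrite -cA; apply: subset_leq_card.
  by apply: subset_trans (subsetIl _ _) (subA v vA _); rewrite noedge.
pose d v := if v == w then #|nbr e w| else if v == w' then #|nbr e w'| else t.
have nww' : w' != w by apply: contraTneq ww' => ->; rewrite e_irr.
have wC : w \in ~: A by rewrite inE.
have w'C : w' \in ~: A by rewrite inE.
have := @edges_within_del_adj V G (~: A) d w w' wC w'C ww'; rewrite setCK => H.
have {H} : edges_within G setT < edges_within G A + \sum_(v in ~: A) d v.
  apply: H => v; rewrite inE => vA; rewrite /d.
  case: eqP => [->//|/eqP vw]; case: eqP => [->//|/eqP vw'].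
  by rewrite -cA; apply/subset_leq_card/subA; rewrite // vw vw' orbT.
have -> : \sum_(v in ~: A) d v = #|nbr e w| + #|nbr e w'| + t * (#|V| - t - 2).
  rewrite (big_setD1 w) // (big_setD1 w') ?in_setD1 ?nww' //= addnA.
  rewrite {1 2}/d !eqxx (negPf nww'); congr (_ + _).
  rewrite (eq_bigr (fun=> t)) => [|v]; last first.
    by rewrite !in_setD1 /d => /and3P[/negPf-> /negPf->].
  rewrite sum_nat_const mulnC -cCA (cardsD1 w (~: A)) wC (cardsD1 w' (~: A :\ w)).
  by rewrite in_setD1 nww' w'C addnA addKn.
have degw u u' : u \notin A -> (forall v, v \notin A -> e u v -> v = u') ->
    #|nbr e u| <= #|nbr e u :&: A|.+1.
  move=> uA uu'; rewrite -(cardsID A (nbr e u)) -addn1 leq_add2l.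
  apply: leq_trans (subset_leq_card (_ : _ \subset [set u'])) _; last by rewrite cards1.
  by apply/subsetP=> v; rewrite !inE => /andP[vA uv]; rewrite (uu' v vA uv).
have dw : #|nbr e w| <= #|nbr e w :&: A|.+1.
  apply: (degw w w' wA) => v vA wv.
  by case: (out w v wA vA wv) => -[// E _]; rewrite E eqxx in nww'.
have dw' : #|nbr e w'| <= #|nbr e w' :&: A|.+1.
  apply: (degw w' w w'A) => v vA wv.
  by case: (out w' v w'A vA wv) => -[E //]; rewrite E eqxx in nww'.
have iA u : #|nbr e u :&: A| <= t by rewrite -cA; apply/subset_leq_card/subsetIr.
have nV2 : t * (#|V| - t) = t * (#|V| - t - 2) + t.*2.
  have: 1 < #|V| - t by move: nV t_gt1; clear; lia.
  case: (#|V| - t) => [|[|m]] // _; rewrite !mulnS subSS subn1 /=; clear; lia.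
rewrite nV2; move: dw dw' (iA w) (iA w').
have [full|nfull] := boolP (#|nbr e w :&: A| + #|nbr e w' :&: A| == t.*2); last first.
  by move: nfull tA; clear; lia.
suff : edges_within G A < turan_size t s by clear; lia.
have fA u : t <= #|nbr e u :&: A| -> A \subset nbr e u.
  move=> tu; suff <- : nbr e u :&: A = A by apply: subsetIl.
  by apply/eqP; rewrite eqEcard subsetIr cA.
have wfull : A \subset nbr e w.
  by apply: fA; move: full (iA w) (iA w'); clear; lia.
have w'full : A \subset nbr e w'.
  by apply: fA; move: full (iA w) (iA w'); clear; lia.
(* A clique in A extends by both w and w'. *)
have noKA (S : {set V}) : S \subset A -> clique G S -> #|S| < s.
  move=> SA cS; rewrite -ltnS -(ltn_add2r 1) !addn1.
  have [|c1 sz1] := clique_add (v := w) cS.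
    by move=> x xS; have := subsetP wfull x (subsetP SA x xS); rewrite inE.
  have [|c2 sz2] := clique_add (v := w') c1.
    move=> x; rewrite !inE => /predU1P[->|xS]; first by rewrite [adj _ _ _]e_sym.
    by have := subsetP w'full x (subsetP SA x xS); rewrite inE.
  by have := noK c2; rewrite sz2 sz1.
have s_gt1 : 1 < s.
  have [x xA] : exists x, x \in A by apply/card_gt0P; rewrite cA; apply: ltnW t_gt1.
  have := noKA [set x]; rewrite sub1set cards1; apply=> //.
  by apply/cliqueP=> u v; rewrite !inE => /eqP-> /eqP->; rewrite eqxx.
have s1_gt0 : 0 < s.-1 by move: s_gt1; clear; lia.
have sE : s.-1.+1 = s by apply: prednK.
apply: leq_ltn_trans (_ : turan_size t s.-1 < _).
  rewrite -cA; apply: turan_bound => // S SA cS.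
  by rewrite -ltnS sE; apply: noKA.
have st' : s.-1 < t by apply: leq_trans st; rewrite sE ltnW.
by have := turan_size_ltS s1_gt0 st'; rewrite sE.
Qed.

(** In a minimal violation, a cut vertex would contradict subadditivity of
    [slack], and a vertex of degree less than t, or an edge between two of at
    most t vertices of degree t, could be deleted together with too few edges.
    So the graph is tight, and [tight_structure] applies. *)
Lemma sparse_step : 0 < #|V| -> sparse setT.
Proof.
move=> V_gt0; rewrite /sparse cardsT.
have [small|big] := leqP #|V| t.*2.+1.
  have tur : edges_within G setT <= turan_size #|V| t.
    rewrite -cardsT; apply: turan_bound; first exact: ltnW t_gt1.
    by move=> S _ /noK; move: st; clear; lia.
  have [V1|V_gt1] := leqP #|V| 1.
    have E : #|V| = 1 by apply/eqP; rewrite eqn_leq V1.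
    move: tur; rewrite E /turan_size big_ord1 sub0n leqn0 => /eqP->.
    by rewrite /slack /ceil_div add0n divn_small // minn0.
  have slk : slack #|V|.-1 <= 1.
    have := @ceil_div_small #|V|.-1; rewrite /slack => H.
    have {}H := H _; apply: leq_trans (geq_minr _ _) (H _).
    by move: small; clear; lia.
  have := turan_size_block t_gt1 V_gt1 small; move: tur slk; clear; lia.
rewrite leqNgt; apply/negP=> over.
have cC (U : {set V}) : #|~: U| = #|V| - #|U| by rewrite cardsCs setCK.
have cutfree : no_cutvertex e.
  move=> v S vS S0 SvT.
  have [/existsP[x /existsP[y /and3P[xS yS exy]]]|noedge] :=
    boolP [exists x, exists y, [&& x \in S, y \notin v |: S & e x y]].
    by exists x, y.
  exfalso; have := @edges_within_cut V G (v |: S) (~: S).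
  have -> : (v |: S) :|: ~: S = setT by rewrite -setUA setUCr setUT.
  move=> H; have {}H := H _.
  (* The two sides of the cut vertex v, which they share. *)
  have IH1 : sparse (v |: S).
    by apply: IH => //; apply/set0Pn; exists v; rewrite setU11.
  have IH2 : sparse (~: S).
    by apply: IH; [apply/set0Pn; exists v; rewrite inE | apply: nsetT].
  have cS : 0 < #|S| by rewrite card_gt0.
  have SV : #|S| < #|V|.
    by rewrite -cardsT; apply: proper_card; rewrite properT; apply: contraNneq vS => ->; rewrite inE.
  move: IH1 IH2; rewrite /sparse cC cardsU1 vS add1n /= => IH1 IH2.
  have cutE : edges_within G setT <= edges_within G (v |: S) + edges_within G (~: S).
    apply: H => x y; rewrite !inE negbK negb_or => /andP[xS _] /andP[/andP[yv yS] _].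
    apply: contraNN noedge => exy; apply/existsP; exists x; apply/existsP; exists y.
    by rewrite xS !inE negb_or yv yS.
  have := slackD #|S| (#|V| - #|S|).-1.
  have E : #|S| + (#|V| - #|S|).-1 = #|V|.-1 by move: SV; clear; lia.
  rewrite E; have E2 : t * #|V|.-1 = t * #|S| + t * (#|V| - #|S|).-1 by rewrite -mulnDr E.
  move: IH1 IH2 cutE over; rewrite E2; clear.
  move: (slack _) (slack _) (slack _) (t * _) (t * _) => *; lia.
have min_deg v : t <= #|nbr e v|.
  rewrite leqNgt; apply/negP=> dv.
  have IH1 : sparse (setT :\ v).
    apply: IH; last by apply/eqP => /setP/(_ v); rewrite !inE eqxx.
    rewrite -card_gt0; have := cardsD1 v setT; rewrite cardsT in_setT.
    by move: big t_gt1; clear; lia.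
  have cV : #|setT :\ v| = #|V|.-1 by have := cardsD1 v setT; rewrite cardsT in_setT => ->.
  move: IH1 over; rewrite (edges_within_rem G (in_setT v)) setIT /sparse cV => IH1 over.
  have := @slack_add #|V|.-2 1 isT; rewrite addn1.
  have -> : #|V|.-2.+1 = #|V|.-1 by move: big; clear; lia.
  have E : t * #|V|.-1 = t * #|V|.-2 + t.
    have -> : #|V|.-1 = #|V|.-2.+1 by move: big; clear; lia.
    by rewrite mulnS addnC.
  rewrite -/e in over; move: IH1 over dv; rewrite E; clear.
  move: (slack _) (slack _) (t * _) #|nbr e v| => *; lia.
have tight (L : {set V}) : #|L| <= t -> {in L, forall v, #|nbr e v| = t} ->
    {in L &, forall u v, ~~ e u v}.
  move=> Lt degL u v uL vL; apply/negP=> uv.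
  have LV : #|L| < #|V|.-1 by move: Lt big t_gt1; clear; lia.
  have L_gt0 : 0 < #|L| by apply/card_gt0P; exists u.
  have IH1 : sparse (~: L).
    apply: IH; last by apply: nsetT; rewrite -card_gt0.
    by rewrite -card_gt0 cC; move: LV; clear; lia.
  have := @edges_within_del_adj V G L (fun=> t) u v uL vL uv.
  rewrite sum_nat_const => H.
  have {}H : edges_within G setT < edges_within G (~: L) + #|L| * t.
    by apply: H => x /degL->.
  move: IH1; rewrite /sparse cC => IH1.
  have := @slack_add (#|V| - #|L|).-1 #|L| _.
  have -> : (#|V| - #|L|).-1 + #|L| = #|V|.-1 by move: LV; clear; lia.
  have E : t * #|V|.-1 = t * (#|V| - #|L|).-1 + #|L| * t.
    by rewrite [#|L| * t]mulnC -mulnDr; congr (_ * _); move: LV; clear; lia.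
  move=> K; have {}K : slack #|V|.-1 <= (slack (#|V| - #|L|).-1).+1.
    by apply: K; move: Lt; clear; lia.
  move: IH1 over H K; rewrite E; clear.
  move: (slack _) (slack _) (t * _) (_ * t) => *; lia.
have := structure_bound big (tight_structure e_sym e_irr cutfree t_gt1 circ big min_deg tight).
have sl : slack #|V|.-1 <= defect by apply: geq_minl.
have E : t * #|V|.-1 = t * (#|V| - t) + t * t.-1.
  by rewrite -mulnDr; congr (_ * _); move: big t_gt1; clear; lia.
have := turan_size_defect; move: sl over; rewrite E; clear.
move: (slack _) (t * _) (t * _) => *; lia.
Qed.

End Step.

Theorem sparse_all (V : finType) (G : sgraph V) (U : {set V}) :
    (forall S, clique G S -> #|S| <= s.+1) ->
    (forall c, cycle (adj G) c -> uniq c -> size c <= t.*2.+1) ->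
  U != set0 -> sparse G U.
Proof.
move=> noK circ; move: {2}_.+1 (ltnSn #|U|) => n; elim: n U => // n IHn U cU U0.
pose T := {x : V | x \in U}.
pose H : sgraph T := graph_of_rel (relpre val (adj G)).
have adjH (x y : T) : adj H x y = adj G (val x) (val y).
  rewrite adj_graph_of_rel /= (adj_sym G (val y)) orbb andb_idl // => xy.
  by apply: contraTneq xy => ->; rewrite adj_irr.
have val_inj : injective (val : T -> V) by apply: val_inj.
have edgesH (S : {set T}) := edges_within_imset S val_inj adjH.
have im_sub (S : {set T}) : val @: S \subset U.
  by apply/subsetP=> _ /imsetP[y _ ->]; apply: valP.
have imT : val @: [set: T] = U.
  apply/eqP; rewrite eqEsubset im_sub; apply/subsetP=> x xU.
  by apply/imsetP; exists (Sub x xU : T); rewrite ?SubK.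
have cT : #|{: T}| = #|U| by have := card_imset [set: T] val_inj; rewrite imT cardsT => ->.
have sparseE (S : {set T}) : sparse H S = sparse G (val @: S).
  by rewrite /sparse edgesH card_imset.
suff: sparse H setT by rewrite sparseE imT.
apply: sparse_step.
- move=> S /cliqueP cS; rewrite -(card_imset _ val_inj); apply: noK.
  apply/cliqueP=> _ _ /imsetP[x xS ->] /imsetP[y yS ->]; rewrite (inj_eq val_inj) => xy.
  by rewrite -adjH cS.
- move=> c cc uc; rewrite -(size_map val); apply: circ; last by rewrite map_inj_uniq.
  rewrite cycle_map; move: cc; rewrite (@eq_cycle _ (adj H) (relpre val (adj G))) //.
- move=> S S0 ST; rewrite sparseE; apply: IHn; last first.
    by have [x xS] := set0Pn _ S0; apply/set0Pn; exists (val x); apply: imset_f.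
  rewrite card_imset //; apply: leq_trans (_ : #|S| < #|U|) cU.
  by rewrite -cT -cardsT; apply: proper_card; rewrite properT.
by rewrite cT card_gt0.
Qed.

Lemma edges_bound (V : finType) (G : sgraph V) :
    (forall S, clique G S -> #|S| <= s.+1) ->
    (forall c, cycle (adj G) c -> uniq c -> size c <= t.*2.+1) ->
    t.*2.+1 ^ 3 <= 4 * #|V| ->
  num_edges G <= t * (#|V| - t) + turan_size t s.
Proof.
move=> noK circ nV.
have tt := t_gt1; have V0 : 0 < #|V|.
  by move: nV; case: #|V|; rewrite // muln0 leqn0 expn_eq0.
have tV : t < #|V| by move: nV; rewrite !expnS expn0 muln1 -muln2; nia.
have T0 : [set: V] != set0 by rewrite -card_gt0 cardsT.
have := sparse_all noK circ T0; rewrite /sparse cardsT edges_within_setT.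
have -> : slack #|V|.-1 = defect.
  apply/minn_idPl; rewrite leqNgt; apply/negP=> small.
  have: ceil_div #|V|.-1 <= defect.-1 by rewrite -ltnS prednK //; apply: leq_ltn_trans small.
  rewrite ceil_div_le.
  have : defect <= t * t.-1 by apply: leq_subr.
  move: nV V0 tt; rewrite !expnS expn0 muln1; move: small; clear.
  move: (ceil_div _) defect => a D; case: D => [|D] //= _.
  case: #|V| => [|n] //= h _; case: t h => [|[|u]] //= h _ h1 h2.
  by move: h h1 h2; rewrite -!muln2; nia.
have E : t * #|V|.-1 = t * (#|V| - t) + t * t.-1.
  by rewrite -mulnDr; congr (_ * _); move: tV tt; clear; lia.
have := turan_size_defect; rewrite E; clear; lia.
Qed.

End UpperBound.

(** * The extremal graph *)

Section Containment.

Lemma adj_turan m s (x y : 'I_m) :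
  adj (turan_graph m s) x y = (x %% s != y %% s).
Proof.
rewrite adj_graph_of_rel (eq_sym (y %% s)) orbb andb_idl //.
by apply: contraNneq => ->.
Qed.

Lemma contains_complete (V : finType) (G : sgraph V) (S : {set V}) r :
  clique G S -> r <= #|S| -> contains G (complete_graph r).
Proof.
move=> /cliqueP cS rS; exists (fun i => enum_val (widen_ord rS i)).
split=> [i j /enum_val_inj/(congr1 val)/= ij|i j]; first exact: val_inj.
rewrite adj_graph_of_rel => /andP[ij _]; apply: cS; try exact: enum_valP.
by apply: contra ij => /eqP/enum_val_inj/(congr1 val)/= E; apply/eqP/val_inj.
Qed.

Lemma cycle_nth (T : Type) (e : rel T) x0 c i :
  cycle e c -> i < size c -> e (nth x0 c i) (nth x0 c (i.+1 %% size c)).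
Proof.
case: c => // x p /(pathP x0) H ip; have := H i; rewrite size_rcons => /(_ ip).
rewrite -rcons_cons (nth_rcons _ (x :: p)) ip nth_rcons.
have [ip'|ip'|->] := ltngtP i (size p).
- by rewrite modn_small.
- by move: ip; rewrite ltnS leqNgt ip'.
- by rewrite modnn.
Qed.

Lemma contains_cycle (V : finType) (G : sgraph V) c :
  cycle (adj G) c -> uniq c -> contains G (cycle_graph (size c)).
Proof.
case: c => [|x p] cc uc.
  by exists (fun i : 'I_0 => match i with Ordinal m lt_m0 => match notF lt_m0 with end end); split=> -[].
pose c := x :: p; exists (fun i : 'I_(size c) => nth x c i); split=> [i j|i j].
  by move/eqP; rewrite nth_uniq // => /eqP/val_inj.
rewrite adj_graph_of_rel => /andP[_ /orP[] /eqP->].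
  exact: (cycle_nth x cc (ltn_ord i)).
by rewrite adj_sym; apply: (cycle_nth x cc (ltn_ord j)).
Qed.

Lemma transport_graph (V W : finType) (H : sgraph W) : #|V| = #|W| ->
  exists G : sgraph V, num_edges G = num_edges H /\
    forall F, free F H -> free F G.
Proof.
move=> cVW; pose g (x : V) : W := enum_val (cast_ord cVW (enum_rank x)).
have g_inj : injective g by move=> x y /enum_val_inj/cast_ord_inj/enum_rank_inj.
pose G := graph_of_rel (relpre g (adj H)).
have adjG x y : adj G x y = adj H (g x) (g y).
  rewrite adj_graph_of_rel /= (adj_sym H (g y)) orbb andb_idl // => xy.
  by apply: contraTneq xy => ->; rewrite adj_irr.
exists G; split.
  rewrite -!edges_within_setT (edges_within_imset setT g_inj adjG); congr edges_within.
  by apply/eqP; rewrite eqEcard subsetT card_imset // !cardsT cVW leqnn.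
move=> F fH K FK [f [f_inj fhom]]; apply: (fH K FK); exists (g \o f).
split; first exact: inj_comp.
by move=> x y /fhom; rewrite adjG.
Qed.

End Containment.

Section JoinGraph.
Variables t s m : nat.
Hypothesis s_gt0 : 0 < s.
Let G := join_graph (turan_graph t s) (empty_graph m).

Lemma adj_ll (x y : 'I_t) : adj G (inl x) (inl y) = (x %% s != y %% s).
Proof.
rewrite adj_graph_of_rel !adj_turan (eq_sym (y %% s)) orbb andb_idl //.
by move=> xy; apply: contraNneq xy => -[->].
Qed.

Lemma adj_rl x y : adj G (inr x) (inl y).
Proof. by rewrite adj_graph_of_rel. Qed.

Lemma adj_rr x y : adj G (inr x) (inr y) = false.
Proof. by rewrite adj_graph_of_rel !adj_graph_of_rel !andbF. Qed.

Lemma join_no_clique : ~ contains G (complete_graph s.+2).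
Proof.
move=> [f [f_inj fhom]].
pose col (x : 'I_t + 'I_m) : 'I_s.+1 := inord (if x is inl v then v %% s else s).
have colP x y : adj G x y -> col x != col y.
  have lt v : v %% s < s.+1 by rewrite ltnS ltnW // ltn_pmod.
  case: x => x; case: y => y; rewrite -val_eqE /= !inordK //.
  - by rewrite adj_ll.
  - by move=> _; rewrite neq_ltn ltn_pmod.
  - by move=> _; rewrite neq_ltn ltn_pmod // orbT.
  - by rewrite adj_rr.
have inj : injective (col \o f).
  move=> i j /= E; apply/eqP/negPn/negP=> ij.
  have /fhom/colP : adj (complete_graph s.+2) i j by rewrite adj_graph_of_rel ij.
  by rewrite E eqxx.
by have := leq_card _ inj; rewrite !card_ord ltnn.
Qed.

(** The vertices of the cycle on the independent side are followed by vertices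
    on the other side, so they are at most half of all, and the other side has
    only t vertices. *)
Lemma join_no_cycle l : t.*2 < l -> 1 < l -> ~ contains G (cycle_graph l).
Proof.
move=> tl l_gt1 [f [f_inj fhom]].
pose J := [set i | if f i is inr _ then true else false].
have nextJ i : i \in J -> ordS i \notin J.
  rewrite !inE => iJ; apply/negP=> sJ.
  have : adj (cycle_graph l) i (ordS i).
    rewrite adj_graph_of_rel eqxx /= andbT -val_eqE /=.
    have [il|il] := leqP l i.+1; last by rewrite modn_small // neq_ltn ltnSn.
    have -> : i.+1 = l by apply/eqP; rewrite eqn_leq il ltn_ord.
    by rewrite modnn; apply: contraTneq il => ->; rewrite -ltnNge.
  move/fhom; case: (f i) iJ => // a _; case: (f (ordS i)) sJ => // b _.
  by rewrite adj_rr.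
have cJ : #|J| <= #|~: J|.
  rewrite -(card_imset _ (can_inj (@ordSK l))); apply: subset_leq_card.
  by apply/subsetP=> _ /imsetP[i /nextJ iJ ->]; rewrite inE.
have cJC : #|~: J| <= t.
  have [E|[j0 j0J]] : ~: J = set0 \/ exists j, j \in ~: J.
    by case: (set_0Vmem (~: J)) => [|[j]]; [left | right; exists j].
    by rewrite E cards0.
  have [v0 _] : exists v0 : 'I_t, true by move: j0J; rewrite !inE; case: (f j0) => // v _; exists v.
  pose h i := if f i is inl v then v else v0.
  rewrite -[X in _ <= X]card_ord -(@card_in_imset _ _ h); first exact: max_card.
  move=> i j; rewrite !inE /h; case Ei: (f i) => [a|//] _; case Ej: (f j) => [b|//] _ ab.
  by apply: f_inj; rewrite Ei Ej ab.
have := cardsC J; rewrite card_ord; move: cJ cJC tl; clear; lia.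
Qed.

(** Add the vertices one by one, first those of the Turan graph and then the
    independent ones, each of which brings t edges. *)
Lemma join_edges : t * m + turan_size t s <= num_edges G.
Proof.
pose L j := [set x : 'I_t + 'I_m | if x is inl v then v < j else false].
pose R j := [set x : 'I_t + 'I_m | if x is inr w then w < j else true].
have EL j : j <= t -> turan_size j s <= edges_within G (L j).
  elim: j => [|j IHj] jt; first by rewrite /turan_size big_ord0.
  pose x : 'I_t + 'I_m := inl (Ordinal jt).
  have xL : x \in L j.+1 by rewrite inE /x /= ltnSn.
  rewrite (edges_within_rem G xL) turan_size_recr.
  have -> : L j.+1 :\ x = L j.
    apply/setP=> -[v|w]; rewrite !inE ?andbF //.
    rewrite ltnS (leq_eqVlt v); case: (eqVneq (v : nat) j) => [vj|vj] /=.
      by rewrite vj ltnn andbT; apply/negbTE/negPn; rewrite /x; apply/eqP; congr inl; apply: val_inj.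
    by rewrite andb_idl // => _; apply: contraNneq vj => -[->].
  rewrite leq_add ?IHj ?(ltnW jt) //.
  pose C := [set v : 'I_t | v < j & v %% s == j %% s].
  pose B := [set v : 'I_t | v < j].
  have cB : #|B| = j.
    have -> : B = [set widen_ord (ltnW jt) i | i in 'I_j].
      apply/setP=> v; rewrite inE; apply/idP/imsetP=> [vj|[i _ ->]]; last exact: (ltn_ord i).
      by exists (Ordinal vj) => //; apply: val_inj.
    by rewrite card_imset ?card_ord // => a b /(congr1 val)/= ab; apply: val_inj.
  (* Vertices below j with the residue of j are determined by their quotient,
     which is less than j / s. *)
  have cC : #|C| <= j %/ s.
    rewrite cardE -(size_map (fun v : 'I_t => v %/ s)) -(size_iota 0 (j %/ s)).
    apply: uniq_leq_size.
      rewrite map_inj_in_uniq ?enum_uniq // => a b; rewrite !mem_enum !inE.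
      move=> /andP[_ /eqP am] /andP[_ /eqP bm] ab; apply: val_inj.
      by rewrite /= (divn_eq a s) (divn_eq b s) ab am bm.
    move=> q /mapP[v]; rewrite mem_enum inE => /andP[vj /eqP vm] ->.
    rewrite mem_iota add0n /=; move: vj.
    by rewrite {1}(divn_eq v s) {1}(divn_eq j s) vm ltn_add2r ltn_pmul2r.
  have -> : nbr (adj G) x :&: L j.+1 = inl @: (B :\: C).
    apply/setP=> -[v|w]; rewrite !inE; last first.
      by rewrite andbF; apply/esym/imsetP=> -[].
    rewrite mem_imset; last by move=> a b [].
    rewrite !inE adj_ll /= negb_and -leqNgt ltnS (leq_eqVlt v).
    case: ltngtP => [vj|vj|vj] //=; rewrite ?andbF ?andbT // 1?eq_sym //.
    by rewrite vj eqxx.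
  rewrite card_imset; last by move=> a b [].
  rewrite cardsD (setIidPr _) ?cB; first by apply: leq_sub2l.
  by apply/subsetP=> v; rewrite !inE => /andP[].
have ER j : j <= m -> t * j + turan_size t s <= edges_within G (R j).
  elim: j => [|j IHj] jm.
    have -> : R 0 = L t by apply/setP=> -[v|w]; rewrite !inE ?ltn_ord.
    by rewrite muln0; apply: EL.
  pose x : 'I_t + 'I_m := inr (Ordinal jm).
  have xR : x \in R j.+1 by rewrite inE /x /= ltnSn.
  rewrite (edges_within_rem G xR).
  have -> : R j.+1 :\ x = R j.
    apply/setP=> -[v|w]; rewrite !inE //.
    rewrite ltnS (leq_eqVlt w); case: (eqVneq (w : nat) j) => [wj|wj] /=.
      by rewrite wj ltnn andbT; apply/negbTE/negPn; rewrite /x; apply/eqP; congr inr; apply: val_inj.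
    by rewrite andb_idl // => _; apply: contraNneq wj => -[->].
  have -> : nbr (adj G) x :&: R j.+1 = inl @: [set: 'I_t].
    apply/setP=> -[v|w]; rewrite !inE.
      by rewrite adj_rl mem_imset ?inE // => a b [].
    by rewrite adj_rr; apply/esym/imsetP=> -[].
  rewrite card_imset ?cardsT ?card_ord; last by move=> a b [].
  by rewrite mulnS -addnA addnC leq_add2r IHj // ltnW.
have := ER m (leqnn m); rewrite -edges_within_setT.
by have -> : R m = setT by apply/setP=> -[v|w]; rewrite !inE ?ltn_ord.
Qed.

End JoinGraph.

Theorem theorem5 (k r n : nat)
    (hk : 5 <= k) (hn : k <= n)
    (hr3 : 3 <= r) (hr : r <= (k - 1) %/ 2 + 1)
    (hnk : k ^ 3 <= 4 * n) :
  ex_num n (clique_and_long_cycles r k) =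
  num_edges (join_graph (turan_graph ((k - 1) %/ 2) (r - 2))
                        (empty_graph (n - (k - 1) %/ 2))).
Proof.
set t := (k - 1) %/ 2; set s := r - 2.
have t2k : t.*2 < k by rewrite -muln2; have := leq_trunc_div (k - 1) 2; move: hk; rewrite -/t; clear; lia.
have kt2 : k <= t.*2.+2.
  by have := divn_eq (k - 1) 2; have := ltn_pmod (k - 1) (isT : 0 < 2); rewrite -/t; clear; lia.
have s_gt0 : 0 < s by rewrite subn_gt0.
have rE : r = s.+2 by rewrite /s; move: hr3; clear; lia.
have st : s < t by move: hr; rewrite -/t rE; clear; lia.
have tn : t <= n by move: t2k hn; clear; lia.
apply/eqP; rewrite eqn_leq; apply/andP; split.
  apply/bigmax_leqP=> G /boolp.asboolP freeG.
  apply: leq_trans (join_edges t (n - t) s_gt0).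
  have := @edges_bound t s s_gt0 st _ G; rewrite card_ord; apply.
  - move=> S cS; rewrite leqNgt; apply/negP=> Sr.
    apply: (freeG (FGraph (complete_graph r))); first by left.
    by apply: contains_complete cS _; rewrite rE.
  - move=> c cc uc; rewrite leqNgt; apply/negP=> ct.
    apply: (freeG (FGraph (cycle_graph (size c)))); last exact: contains_cycle.
    by right; exists (size c) => //; apply: leq_trans kt2 ct.
  - apply: leq_trans hnk; rewrite leq_exp2r //.
have cV : #|'I_n| = #|{: 'I_t + 'I_(n - t)}| by rewrite card_sum !card_ord subnKC.
have [G [<- freeG]] := transport_graph (join_graph (turan_graph t s) (empty_graph (n - t))) cV.
apply: (@leq_bigmax_cond _ _ (fun G : sgraph 'I_n => num_edges G)); apply/boolp.asboolP/freeG.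
move=> K [->|[l kl <-]].
  by rewrite /= rE; apply: join_no_clique.
apply: join_no_cycle; first exact: leq_trans t2k kl.
by apply: leq_trans kl; apply: leq_trans hk.
Qed.
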